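(* Consider the following single machine scheduling problem. A set $N = N_1 \cup N_2$ of $n$ jobs ($N_1\cap N_2=\emptyset$) is to be processed on a single machine from time $0$ on, the machine processing at most one job at a time, without preemption. Each job $j$ has processing time $p_j = p$ (the same value $p>0$ for all jobs), a release date $r_j > 0$ (job $j$ cannot start before $r_j$), a due date $d_j$ and a weight $w_j \ge 0$. The jobs of $N_1 = \{j^1_1,\dots,j^1_{n_1}\}$ form a chain $j^1_1 \to j^1_2 \to \dots \to j^1_{n_1}$ and the jobs of $N_2=\{i_1,\dots,i_{n_2}\}$ form a chain $i_1\to i_2\to\dots\to i_{n_2}$, where $j \to i$ means job $j$ must be processed before job $i$. For a feasible schedule, let $C_j$ be the completion time of job $j$ and $T_j=\max\{0, C_j - d_j\}$ its tardiness. Then, for each of the objectives $f = \sum_{j\in N} w_j C_j$ and $f = \sum_{j\in N} w_j T_j$, the problem of finding a feasible schedule minimizing $f$ (denoted $1|2\ chains, p_j=p, r_j|f$) can be solved by a dynamic programming algorithm in $O(n^5)$ time.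
   Context: Schedules are given by a permutation of the jobs respecting both chains; each job starts at the maximum of its release date and the completion time of the previous job in the permutation. *)

(* Defs.v *)
From mathcomp Require Import all_boot all_order all_algebra.
Set Implicit Arguments. Unset Strict Implicit. Unset Printing Implicit Defensive.
Import Order.TTheory GRing.Theory Num.Theory.
Local Open Scope ring_scope.

(* 1. Model of computation: a unit-cost real RAM.                         *)
(*    Two register files: natural-number registers N[.] (used for indices *)
(*    and addresses, with indirect addressing) and real registers R[.]    *)
(*    (holding the numeric data), each instruction costs one step.        *)

Inductive instr : Type :=
| NConst of nat & nat
| NAdd of nat & nat & nat
| NSub of nat & nat & nat      (* NSub i j k   : N[i] := N[j] - N[k] (truncated) *)
| NMul of nat & nat & nat
| NLoad of nat & nat
| NStore of nat & nat
| RZero of nat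
| ROne of nat
| RAdd of nat & nat & nat
| RSub of nat & nat & nat
| RMul of nat & nat & nat
| RDiv of nat & nat & nat
| RLoad of nat & nat
| RStore of nat & nat
| NJle of nat & nat & nat
| RJle of nat & nat & nat
| Jmp of nat
| Halt.

Definition program := seq instr.

Record state (R : realFieldType) := State {
  pc : nat; nreg : nat -> nat; rreg : nat -> R }.

Definition upd (T : Type) (f : nat -> T) (i : nat) (v : T) : nat -> T :=
  fun x => if x == i then v else f x.

Section Machine.
Variable R : realFieldType.
Variable P : program.

(* One step; [None] means the machine has halted (Halt or pc out of range). *)
Definition step (s : state R) : option (state R) :=
  let: State q N X := s in
  let nxt := q.+1 in
  match nth Halt P q with
  | NConst i k => Some (State nxt (upd N i k) X)
  | NAdd i j k => Some (State nxt (upd N i (N j + N k)%N) X)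
  | NSub i j k => Some (State nxt (upd N i (N j - N k)%N) X)
  | NMul i j k => Some (State nxt (upd N i (N j * N k)%N) X)
  | NLoad i j => Some (State nxt (upd N i (N (N j))) X)
  | NStore i j => Some (State nxt (upd N (N i) (N j)) X)
  | RZero i => Some (State nxt N (upd X i 0))
  | ROne i => Some (State nxt N (upd X i 1))
  | RAdd i j k => Some (State nxt N (upd X i (X j + X k)))
  | RSub i j k => Some (State nxt N (upd X i (X j - X k)))
  | RMul i j k => Some (State nxt N (upd X i (X j * X k)))
  | RDiv i j k => Some (State nxt N (upd X i (X j / X k)))
  | RLoad i j => Some (State nxt N (upd X i (X (N j))))
  | RStore i j => Some (State nxt N (upd X (N i) (X j)))
  | NJle i j l => Some (State (if (N i <= N j)%N then l else nxt) N X)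
  | RJle i j l => Some (State (if X i <= X j then l else nxt) N X)
  | Jmp l => Some (State l N X)
  | Halt => None
  end.

Fixpoint run (t : nat) (s : state R) : option (state R) :=
  match t with
  | 0 => Some s
  | t'.+1 => obind (run t') (step s)
  end.

Definition halts_in (s : state R) (t : nat) (s' : state R) : Prop :=
  run t s = Some s' /\ step s' = None.

End Machine.

(*    Jobs are 'I_(n1 + n2): jobs 0 .. n1-1 form the chain N1 (in this    *)
(*    order), jobs n1 .. n1+n2-1 form the chain N2 (in this order).       *)

Section Scheduling.
Variable R : realFieldType.
Variables n1 n2 : nat.
Local Notation n := (n1 + n2)%N.
Variable p : R.
Variables r d w : 'I_n -> R.

Definition prec (j k : 'I_n) : bool :=
  ((j < k)%N && (k < n1)%N) || ((n1 <= j)%N && (j < k)%N).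

Definition feasible (s : seq 'I_n) : bool :=
  perm_eq s (enum 'I_n) &&
  [forall j : 'I_n, forall k : 'I_n, prec j k ==> (index j s < index k s)%N].

Fixpoint completions (t : R) (s : seq 'I_n) : seq R :=
  match s with
  | [::] => [::]
  | j :: s' => let c := Num.max (r j) t + p in c :: completions c s'
  end.

Definition Cj (s : seq 'I_n) (j : 'I_n) : R := nth 0 (completions 0 s) (index j s).

Definition Tj (s : seq 'I_n) (j : 'I_n) : R := Num.max 0 (Cj s j - d j).

End Scheduling.

Inductive objective := SumWC | SumWT.

Definition cost (R : realFieldType) (obj : objective) n1 n2 (p : R)
  (r d w : 'I_(n1 + n2) -> R) (s : seq 'I_(n1 + n2)) : R :=
  match obj with
  | SumWC => \sum_(j < n1 + n2) w j * Cj p r s j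
  | SumWT => \sum_(j < n1 + n2) w j * Tj p r d s j
  end.

Definition optimal (R : realFieldType) (obj : objective) n1 n2 (p : R)
  (r d w : 'I_(n1 + n2) -> R) (s : seq 'I_(n1 + n2)) : Prop :=
  feasible s /\
  forall s', feasible s' -> cost obj p r d w s <= cost obj p r d w s'.

(*  Input : N[0] = n1, N[1] = n2, all other N registers 0;                  *)
(*          R[0] = p, and for job j < n: R[1+3j] = r_j, R[2+3j] = d_j,      *)
(*          R[3+3j] = w_j; all other R registers 0; pc = 0.                 *)
(*  Output: N[0], ..., N[n-1] list the jobs in processing order.            *)

Definition ext (R : realFieldType) n (f : 'I_n -> R) (j : nat) : R :=
  if insub j is Some o then f o else 0.

Definition init_state (R : realFieldType) n1 n2 (p : R)
  (r d w : 'I_(n1 + n2) -> R) : state R :=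
  State 0
    (fun x => if x == 0%N then n1 else if x == 1%N then n2 else 0%N)
    (fun x => if x == 0%N then p else
              let j := ((x - 1) %/ 3)%N in
              let m := ((x - 1) %% 3)%N in
              if m == 0%N then ext r j
              else if m == 1%N then ext d j
              else ext w j).

Definition output (R : realFieldType) n (s : state R) : seq 'I_n :=
  pmap insub [seq nreg s k | k <- iota 0 n].

(* Main.v *)
Require Import Defs.
From mathcomp Require Import all_boot all_order all_algebra.
From mathcomp Require Import zify.
Import Order.TTheory GRing.Theory Num.Theory.
Set Implicit Arguments. Unset Strict Implicit. Unset Printing Implicit Defensive.
Local Open Scope ring_scope.

(* A completion time is always of the form [r_i + k p], where [i] is the job that
   started the current block of uninterrupted processing and [k] the position in
   that block.  A state of the dynamic program is therefore [(a, b, i, k)], with [a]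
   and [b] jobs left in the two chains; the successor of such a state is found in
   constant time, without searching for its completion time: it is [(i, k + 1)] if
   the next job has already been released and [(j, 1)] if the machine waits for job
   [j].  There are [O(n^4)] states.  Time 0 is encoded by a fictitious job [n]
   released at 0, and [SumWC] is [SumWT] with all due dates 0 since completion times
   are positive.  The schedule is read off the table by a forward pass that repeats
   the comparison at each visited state. *)

(** The recursion [dp] takes the start time as a real number; the indices (i, k) occur only in the
    table, whose entry at (a, b, i, k) is the value of [dp] at time r_i + k p. Entries are filled
    for all quadruples with k + a + b <= n, whether or not some schedule reaches that time: [dp]
    makes sense from any start time, so reachability never has to be characterised. Each entry takes
    a constant number of steps, hence the running time is at most of order n^4, within the required
    n^5. The remaining obstacles come from the machine. Its jumps have absolute targets, so the
    program is written with structured commands and compiled. *)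

(** * Structured commands and their compilation to absolute jumps *)

Inductive cmd : Type :=
| Skip
| Ins of instr
| Seq of cmd & cmd
| IfN of nat & nat & cmd & cmd
| IfR of nat & nat & cmd & cmd
| While of nat & nat & cmd.

Definition block (l : seq instr) : cmd := foldr (fun i c => Seq (Ins i) c) Skip l.

Fixpoint csize (c : cmd) : nat :=
  match c with
  | Skip => 0
  | Ins _ => 1
  | Seq c1 c2 => csize c1 + csize c2
  | IfN _ _ c1 c2 | IfR _ _ c1 c2 => (csize c1 + csize c2).+2
  | While _ _ c => (csize c).+2
  end%N.

(* [IfN i j c1 c2] runs [c1] when N[i] <= N[j], and [While i j c] runs [c] as
   long as N[i] < N[j]. *)
Fixpoint comp (q : nat) (c : cmd) : seq instr :=
  match c with
  | Skip => [::]
  | Ins i => [:: i]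
  | Seq c1 c2 => comp q c1 ++ comp (q + csize c1) c2
  | IfN i j c1 c2 =>
      NJle i j (q + csize c2).+2 :: comp q.+1 c2 ++
      Jmp (q + csize c2 + csize c1).+2 :: comp (q + csize c2).+2 c1
  | IfR i j c1 c2 =>
      RJle i j (q + csize c2).+2 :: comp q.+1 c2 ++
      Jmp (q + csize c2 + csize c1).+2 :: comp (q + csize c2).+2 c1
  | While i j c =>
      NJle j i (q + csize c).+2 :: comp q.+1 c ++ [:: Jmp q]
  end%N.

Lemma size_comp c q : size (comp q c) = csize c.
Proof.
elim: c q => //= [c1 IH1 c2 IH2|i j c1 IH1 c2 IH2|i j c1 IH1 c2 IH2|i j c IH] q;
  rewrite ?size_cat /= ?size_cat /= ?IH1 ?IH2 ?IH /=; lia.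
Qed.

(** Nothing is said about the rest of [P], so a fact about a fragment can be used inside any larger
    program, at any offset. *)
Definition code_at (P : program) (q : nat) (l : seq instr) : Prop :=
  forall i, (i < size l)%N -> nth Halt P (q + i) = nth Halt l i.

Lemma code_at_cons P q i l :
  code_at P q (i :: l) -> nth Halt P q = i /\ code_at P q.+1 l.
Proof.
move=> h; split; first by have := h 0%N isT; rewrite addn0.
by move=> k kl; rewrite addSnnS h.
Qed.

Lemma code_at_cat P q l1 l2 :
  code_at P q (l1 ++ l2) -> code_at P q l1 /\ code_at P (q + size l1) l2.
Proof.
move=> h; split=> i il; first by rewrite h ?nth_cat ?il // size_cat ltn_addr.
by rewrite -addnA h ?nth_cat ?size_cat ?ltn_add2l // ifF ?addKn //; lia.
Qed.

(** * Total correctness with time bounds, and frame rules *)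

Section Semantics.
Variable R : realFieldType.

Definition store : Type := ((nat -> nat) * (nat -> R))%type.

Definition at_pc (q : nat) (s : store) : state R := State q s.1 s.2.

Definition ev_ins (i : instr) (s : store) : store :=
  let: (N, X) := s in
  match i with
  | NConst i k => (upd N i k, X)
  | NAdd i j k => (upd N i (N j + N k)%N, X)
  | NSub i j k => (upd N i (N j - N k)%N, X)
  | NMul i j k => (upd N i (N j * N k)%N, X)
  | NLoad i j => (upd N i (N (N j)), X)
  | NStore i j => (upd N (N i) (N j), X)
  | RZero i => (N, upd X i 0)
  | ROne i => (N, upd X i 1)
  | RAdd i j k => (N, upd X i (X j + X k))
  | RSub i j k => (N, upd X i (X j - X k))
  | RMul i j k => (N, upd X i (X j * X k))
  | RDiv i j k => (N, upd X i (X j / X k))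
  | RLoad i j => (N, upd X i (X (N j)))
  | RStore i j => (N, upd X (N i) (X j))
  | _ => s
  end.

Definition straight (i : instr) : bool :=
  if i is (NJle _ _ _ | RJle _ _ _ | Jmp _ | Halt) then false else true.

Lemma step_straight P q i s :
  nth Halt P q = i -> straight i -> step P (at_pc q s) = Some (at_pc q.+1 (ev_ins i s)).
Proof. by case: s => N X; rewrite /step /at_pc /= => ->; case: i. Qed.

Lemma run_add P t1 t2 (s s' : state R) :
  run P t1 s = Some s' -> run P (t1 + t2) s = run P t2 s'.
Proof.
elim: t1 s => [|t IH] s /=; first by case=> ->.
by case: (step P s) => //= s1 /IH.
Qed.

Lemma run_S P t (s : state R) : run P t.+1 s = obind (run P t) (step P s).
Proof. by []. Qed.

(** The step count [t] and the final store are chosen before [P] and [q]: the effect of a command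
    depends neither on where its code sits nor on the code around it. *)
Definition tot (c : cmd) (T : nat) (s : store) (Q : store -> Prop) : Prop :=
  exists t s', [/\ (t <= T)%N, Q s' & forall P q, code_at P q (comp q c) ->
    run P t (at_pc q s) = Some (at_pc (q + csize c) s')].

Lemma tot_conseq c T T' s (Q Q' : store -> Prop) :
  (T <= T')%N -> (forall s', Q s' -> Q' s') -> tot c T s Q -> tot c T' s Q'.
Proof.
move=> hT hQ [t [s' [ht hs h]]]; exists t, s'; split=> //; last exact: hQ.
exact: leq_trans hT.
Qed.

Lemma tot_seq c1 c2 T1 T2 s Q :
  tot c1 T1 s (fun s1 => tot c2 T2 s1 Q) -> tot (Seq c1 c2) (T1 + T2) s Q.
Proof.
move=> [t1 [s1 [h1 [t2 [s2 [h2 hQ r2]]] r1]]].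
exists (t1 + t2)%N, s2; split=> //; first exact: leq_add.
move=> P q /= /code_at_cat; rewrite size_comp => -[/r1 e1 /r2 e2].
by rewrite (run_add _ e1) e2 addnA.
Qed.

(** Serves both [IfN] and [IfR], the test being abstracted into [b]. The code of [c2] comes before
    that of [c1] and ends by jumping over it, whence one extra step for [c1] and two for [c2]. *)
Lemma run_if_comp (P : program) (q t1 t2 : nat) (b : bool) (c1 c2 : cmd)
    (i : instr) (s s1 s2 : store) :
  code_at P q (i :: comp q.+1 c2 ++ Jmp (q + csize c2 + csize c1).+2
                 :: comp (q + csize c2).+2 c1) ->
  (nth Halt P q = i ->
   step P (at_pc q s) = Some (at_pc (if b then (q + csize c2).+2 else q.+1) s)) ->
  (b -> forall q', code_at P q' (comp q' c1) ->
     run P t1 (at_pc q' s) = Some (at_pc (q' + csize c1) s1)) ->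
  (~~ b -> forall q', code_at P q' (comp q' c2) ->
     run P t2 (at_pc q' s) = Some (at_pc (q' + csize c2) s2)) ->
  run P (if b then t1.+1 else t2.+2) (at_pc q s) =
    Some (at_pc (q + (csize c1 + csize c2).+2) (if b then s1 else s2)).
Proof.
move=> /code_at_cons [hi /code_at_cat []]; rewrite size_comp.
move=> k2 /code_at_cons [hj k1] /(_ hi); case: b => hs r1 r2; rewrite run_S hs /obind /oapp.
  by move: k1; rewrite -addSn => k1; rewrite r1 //; congr (Some (at_pc _ _)); lia.
have e := r2 isT _ k2; rewrite -addn1 (run_add _ e) /=.
by rewrite hj /=; congr (Some (State _ _ _)); lia.
Qed.

Fixpoint loopfree (c : cmd) : bool :=
  match c with
  | Skip => true
  | Ins i => straight i
  | Seq c1 c2 | IfN _ _ c1 c2 | IfR _ _ c1 c2 => loopfree c1 && loopfree c2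
  | While _ _ _ => false
  end.

Fixpoint ev (c : cmd) (s : store) : store :=
  match c with
  | Skip => s
  | Ins i => ev_ins i s
  | Seq c1 c2 => ev c2 (ev c1 s)
  | IfN i j c1 c2 => if (s.1 i <= s.1 j)%N then ev c1 s else ev c2 s
  | IfR i j c1 c2 => if s.2 i <= s.2 j then ev c1 s else ev c2 s
  | While _ _ _ => s
  end.

(** Without loops every compiled instruction runs at most once, so the code size bounds the time. *)
Lemma tot_ev c s (Q : store -> Prop) : loopfree c -> Q (ev c s) -> tot c (csize c) s Q.
Proof.
move=> lf hQ; suff: tot c (csize c) s (fun s' => s' = ev c s).
  by apply: tot_conseq => // s' ->.
elim: c lf s {Q hQ} => /= [|i|c1 IH1 c2 IH2|i j c1 IH1 c2 IH2|i j c1 IH1 c2 IH2|//].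
- by move=> _ s; exists 0%N, s; split=> // P q _; rewrite addn0.
- move=> si s; exists 1%N, (ev_ins i s); split=> // P q /code_at_cons [hi _].
  by rewrite run_S (step_straight _ hi si) addn1.
- move=> /andP[/IH1 h1 /IH2 h2] s; apply: tot_seq.
  by apply: tot_conseq (h1 s) => // s' ->.
- move=> /andP[/IH1 h1 /IH2 h2] s.
  have [t1 [_ [l1 -> r1]]] := h1 s; have [t2 [_ [l2 -> r2]]] := h2 s.
  exists (if (s.1 i <= s.1 j)%N then t1.+1 else t2.+2),
    (if (s.1 i <= s.1 j)%N then ev c1 s else ev c2 s).
  split=> //; first by case: ifP => _; lia.
  move=> P q k; apply: run_if_comp k _ _ _ => [hi|_ q'|_ q'].
  + by rewrite /step /at_pc /= hi.
  + exact: r1.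
  + exact: r2.
- move=> /andP[/IH1 h1 /IH2 h2] s.
  have [t1 [_ [l1 -> r1]]] := h1 s; have [t2 [_ [l2 -> r2]]] := h2 s.
  exists (if s.2 i <= s.2 j then t1.+1 else t2.+2), (if s.2 i <= s.2 j then ev c1 s else ev c2 s).
  split=> //; first by case: ifP => _; lia.
  move=> P q k; apply: run_if_comp k _ _ _ => [hi|_ q'|_ q'].
  + by rewrite /step /at_pc /= hi.
  + exact: r1.
  + exact: r2.
Qed.

(** The invariant is indexed by the number of completed rounds, and the second hypothesis makes the
    test fail after exactly [M] of them. A round costs two steps besides its body, the test and the
    jump back; the last, failing test costs one. *)
Lemma tot_while i j c T M (I : nat -> store -> Prop) s :
  I 0%N s ->
  (forall m s, (m <= M)%N -> I m s -> (s.1 i < s.1 j)%N = (m < M)%N) ->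
  (forall m s, (m < M)%N -> I m s -> tot c T s (I m.+1)) ->
  tot (While i j c) (M * (T + 2) + 1) s (I M).
Proof.
move=> I0 hc hb; suff h k m s' : (k + m)%N = M -> I m s' ->
    tot (While i j c) (k * (T + 2) + 1) s' (I M) by apply: h I0; rewrite addn0.
elim: k m s' {I0 s} => [|k IH] m s /= eM Im.
  have := hc _ _ _ Im; rewrite -eM ltnn => /(_ (leqnn _)) /negbT; rewrite -leqNgt => hij.
  exists 1%N, s; split=> // P q /code_at_cons [hi _].
  by rewrite /= hi /= hij; congr (Some (State _ _ _)); lia.
have mM : (m < M)%N by lia.
have := hc _ _ (ltnW mM) Im; rewrite mM => hij.
have [t1 [s1 [l1 I1 r1]]] := hb _ _ mM Im.
have [|t2 [s2 [l2 I2 r2]]] := IH m.+1 s1 _ I1; first by lia.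
exists (t1.+2 + t2)%N, s2; split=> //; first by lia.
(* One round brings the program counter back to [q], so the induction hypothesis applies to the same
   copy of the code. *)
move=> P q k0; rewrite -(r2 _ _ k0); apply: run_add.
move: k0 => /code_at_cons [hi /code_at_cat []].
rewrite size_comp => k1 /code_at_cons [hj _].
have e : step P (at_pc q s) = Some (at_pc q.+1 s) by rewrite /= hi /= leqNgt hij.
by rewrite run_S e -addn1 /obind /oapp (run_add _ (r1 _ _ k1)) /= hj.
Qed.

Lemma tot_halts c T (s : store) (Q : store -> Prop) : tot c T s Q ->
  exists t s', [/\ halts_in (comp 0 c) (at_pc 0 s) t s', (t <= T)%N & Q (nreg s', rreg s')].
Proof.
move=> [t [s' [lt hQ h]]]; exists t, (at_pc (0 + csize c) s'); split=> //; last by case: s' hQ {h}.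
split; first exact: h.
(* The counter has run off the end of the program, where [nth] returns [Halt]. *)
by rewrite /= nth_default // size_comp.
Qed.

Fixpoint nwrites (c : cmd) : seq nat :=
  match c with
  | Ins (NConst i _ | NAdd i _ _ | NSub i _ _ | NMul i _ _ | NLoad i _) => [:: i]
  | Seq c1 c2 | IfN _ _ c1 c2 | IfR _ _ c1 c2 => nwrites c1 ++ nwrites c2
  | _ => [::]
  end.

Fixpoint rwrites (c : cmd) : seq nat :=
  match c with
  | Ins (RZero i | ROne i | RAdd i _ _ | RSub i _ _ | RMul i _ _ | RDiv i _ _ | RLoad i _) =>
    [:: i]
  | Seq c1 c2 | IfN _ _ c1 c2 | IfR _ _ c1 c2 => rwrites c1 ++ rwrites c2
  | _ => [::]
  end.

Fixpoint nostore (c : cmd) : bool :=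
  match c with
  | Ins (NStore _ _ | RStore _ _) => false
  | Seq c1 c2 | IfN _ _ c1 c2 | IfR _ _ c1 c2 => nostore c1 && nostore c2
  | _ => true
  end.

Lemma updN (T : Type) (f : nat -> T) i v x : x != i -> upd f i v x = f x.
Proof. by rewrite /upd => /negbTE ->. Qed.

Lemma upd_eq (T : Type) (f : nat -> T) i v : upd f i v i = v.
Proof. by rewrite /upd eqxx. Qed.

(** [nostore] excludes indirect writes, whose target is known only at run time; all other targets
    can be read off the syntax. *)
Lemma ev_frameN c s x : nostore c -> x \notin nwrites c -> (ev c s).1 x = s.1 x.
Proof.
elim: c s => //= [i|c1 IH1 c2 IH2|i j c1 IH1 c2 IH2|i j c1 IH1 c2 IH2] s.
- by case: s => N X; case: i => //= *; rewrite updN // -mem_seq1.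
- by move=> /andP[? ?]; rewrite mem_cat => /norP[? ?]; rewrite IH2 ?IH1.
- by move=> /andP[? ?]; rewrite mem_cat => /norP[? ?]; case: ifP; rewrite ?IH2 ?IH1.
- by move=> /andP[? ?]; rewrite mem_cat => /norP[? ?]; case: ifP; rewrite ?IH2 ?IH1.
Qed.

Lemma ev_frameR c s x : nostore c -> x \notin rwrites c -> (ev c s).2 x = s.2 x.
Proof.
elim: c s => //= [i|c1 IH1 c2 IH2|i j c1 IH1 c2 IH2|i j c1 IH1 c2 IH2] s.
- by case: s => N X; case: i => //= *; rewrite updN // -mem_seq1.
- by move=> /andP[? ?]; rewrite mem_cat => /norP[? ?]; rewrite IH2 ?IH1.
- by move=> /andP[? ?]; rewrite mem_cat => /norP[? ?]; case: ifP; rewrite ?IH2 ?IH1.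
- by move=> /andP[? ?]; rewrite mem_cat => /norP[? ?]; case: ifP; rewrite ?IH2 ?IH1.
Qed.

End Semantics.

(** * The recursion and its optimality over interleavings *)

Section DP.
Variables (R : realFieldType) (n1 n2 : nat) (p : R) (rr dd ww : nat -> R).
Local Notation n := (n1 + n2)%N.

Definition completion (j : nat) (t : R) : R := Num.max (rr j) t + p.
Definition penalty (j : nat) (c : R) : R := ww j * Num.max 0 (c - dd j).

Fixpoint seqcost (t : R) (s : seq nat) : R :=
  if s is j :: s' then penalty j (completion j t) + seqcost (completion j t) s' else 0.

(* [a] and [b] count the jobs still to be scheduled in each chain, so the next
   candidates are the jobs [n1 - a] and [n1 + n2 - b]; [m] is fuel, meant to be
   [a + b]. *)
Fixpoint dp (m a b : nat) (t : R) : R * seq nat :=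
  if m is m'.+1 then
    let go j x := (penalty j (completion j t) + x.1, j :: x.2) in
    let o1 := go (n1 - a)%N (dp m' a.-1 b (completion (n1 - a) t)) in
    let o2 := go (n - b)%N (dp m' a b.-1 (completion (n - b) t)) in
    if (a <= 0)%N then o2 else if (b <= 0)%N then o1 else
    if o1.1 <= o2.1 then o1 else o2
  else (0, [::]).

(** The interleavings of what remains of the two chains, recognised by their restrictions to each
    chain. *)
Definition shuffle (a b : nat) (s : seq nat) : bool :=
  ([seq x <- s | x < n1]%N == iota (n1 - a) a) &&
  ([seq x <- s | n1 <= x]%N == iota (n - b) b).

Lemma dp_cost m a b t : (dp m a b t).1 = seqcost t (dp m a b t).2.
Proof.
elim: m a b t => [|m IH] a b t //=.
case: ifP => _ /=; first by rewrite IH.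
by case: ifP => _ /=; [|case: ifP => _ /=]; rewrite IH.
Qed.

Lemma shuffle_consl a b s : (a < n1)%N ->
  shuffle a.+1 b ((n1 - a.+1)%N :: s) = shuffle a b s.
Proof.
move=> h; have h1 : (n1 - a.+1 < n1)%N by lia.
rewrite /shuffle /= h1 [X in if X then _ else _]leqNgt h1 eqseq_cons eqxx /=.
by rewrite -subSn // subSS.
Qed.

Lemma shuffle_consr a b s : (b < n2)%N ->
  shuffle a b.+1 ((n - b.+1)%N :: s) = shuffle a b s.
Proof.
move=> h; have h1 : (n1 <= n - b.+1)%N by lia.
rewrite /shuffle /= h1 [X in if X then _ else _]ltnNge h1 eqseq_cons eqxx /=.
by rewrite -subSn ?subSS //; lia.
Qed.

Lemma shuffle_cons a b j s : (a <= n1)%N -> (b <= n2)%N -> shuffle a b (j :: s) ->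
  [/\ (0 < a)%N, j = (n1 - a)%N & shuffle a.-1 b s] \/
  [/\ (0 < b)%N, j = (n - b)%N & shuffle a b.-1 s].
Proof.
move=> ha hb; case: (ltnP j n1) => hj h; [left|right]; move: (h).
  rewrite /shuffle /= hj; case: a ha h => [|a] ha h; rewrite ?andFb //=
    eqseq_cons => /andP[/andP[/eqP e _] _].
  by split=> //; move: h; rewrite e shuffle_consl.
rewrite /shuffle /= hj ltnNge hj /=; case: b hb h => [|b] hb h; rewrite ?andbF //=
  eqseq_cons => /andP[_ /andP[/eqP e _]].
by split=> //; move: h; rewrite e shuffle_consr.
Qed.

Lemma dp_shuffle m a b t : m = (a + b)%N -> (a <= n1)%N -> (b <= n2)%N ->
  shuffle a b (dp m a b t).2.
Proof.
elim: m a b t => [|m IH] a b t /=.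
  by move=> h; have [-> ->] : a = 0%N /\ b = 0%N by lia.
case: a => [|a] /=; case: b => [|b] //= e ha hb; last case: ifP => _ /=.
all: by rewrite ?shuffle_consl ?shuffle_consr //; apply: IH; lia.
Qed.

(** Bellman's principle: the head of [s] must be the next job of one of the chains, and once it is
    fixed so is the time at which the rest starts, so the induction hypothesis compares tails that
    start at the same time. *)
Lemma dp_le m a b t s : m = (a + b)%N -> (a <= n1)%N -> (b <= n2)%N ->
  shuffle a b s -> (dp m a b t).1 <= seqcost t s.
Proof.
elim: m a b t s => [|m IH] a b t s /=.
  move=> h; have [-> ->] : a = 0%N /\ b = 0%N by lia.
  by case: s => //= j s _ _ /(shuffle_cons (leq0n _) (leq0n _)) [][].
move=> e ha hb; case: s => [|j s] hs.
  (* The empty sequence interleaves only empty chains, against [m.+1 = a + b]. *)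
  by exfalso; move: hs e; rewrite /shuffle /=; case: a {ha} => [|a]; case: b {hb} => [|b].
have [[a0 -> h]|[b0 -> h]] := shuffle_cons ha hb hs => /=.
  have h1 : penalty (n1 - a) (completion (n1 - a) t) + (dp m a.-1 b (completion (n1 - a) t)).1 <=
         penalty (n1 - a) (completion (n1 - a) t) + seqcost (completion (n1 - a) t) s.
    by rewrite lerD2l; apply: IH => //; lia.
  rewrite leqNgt a0 /=; case: ifP => // _.
  by case: ifP => //= /negbT; rewrite -ltNge => /ltW h2; apply: le_trans h2 h1.
have h1 : penalty (n - b) (completion (n - b) t) + (dp m a b.-1 (completion (n - b) t)).1 <=
         penalty (n - b) (completion (n - b) t) + seqcost (completion (n - b) t) s.
  by rewrite lerD2l; apply: IH => //; lia.
case: ifP => _ //; rewrite [(b <= 0)%N]leqNgt b0 /=.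
by case: ifP => //= h2; apply: le_trans h2 h1.
Qed.

Lemma size_shuffle a b s : shuffle a b s -> size s = (a + b)%N.
Proof.
case/andP=> /eqP e1 /eqP e2; have := count_predC (fun x => x < n1)%N s.
rewrite -!size_filter e1 (_ : [seq x <- s | _] = iota (n - b) b) ?size_iota //.
by rewrite -e2; apply: eq_filter => x /=; rewrite -leqNgt.
Qed.

End DP.

(** * Feasible schedules as interleavings, and their cost *)

Section Feasible.
Variables (R : realFieldType) (n1 n2 : nat).
Local Notation n := (n1 + n2)%N.

(** Carries precedence constraints between a schedule and its restriction to one chain. *)
Lemma index_filter_lt (T : eqType) (q : pred T) (s : seq T) x y : q x -> q y ->
  (index x (filter q s) < index y (filter q s))%N = (index x s < index y s)%N.
Proof.
move=> qx qy; elim: s => //= z s IH; case: ifP => qz /=.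
  by case: eqP => // _; case: eqP => //.
have -> : (z == x) = false by apply/eqP => e; rewrite e qx in qz.
by have -> : (z == y) = false by apply/eqP => e; rewrite e qy in qz.
Qed.

(** The index condition makes [s] strictly increasing, and a strictly increasing sequence is
    determined by its set of elements. *)
Lemma iota_sorted_unique (s : seq nat) m k : perm_eq s (iota m k) ->
  (forall x y, x \in s -> y \in s -> x < y -> index x s < index y s)%N -> s = iota m k.
Proof.
move=> hp h; have us : uniq s by rewrite (perm_uniq hp) iota_uniq.
apply: (irr_sorted_eq ltn_trans ltnn) => //; [|exact: iota_ltn_sorted|exact: perm_mem].
apply: pairwise_sorted; apply/(pairwiseP 0%N) => i j hi hj ij.
rewrite ltnNge leq_eqVlt; apply/negP => /orP[/eqP|] e.
  by have := nth_uniq 0%N hj hi us; rewrite e eqxx; lia.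
by have := h _ _ (mem_nth _ hj) (mem_nth _ hi) e; rewrite !index_uniq //; lia.
Qed.

Lemma filter_iota_all (q : pred nat) m k : (forall x, m <= x < m + k -> q x)%N ->
  filter q (iota m k) = iota m k.
Proof. by move=> h; apply/all_filterP/allP => x; rewrite mem_iota => /h. Qed.

Lemma filter_iota_none (q : pred nat) m k : (forall x, m <= x < m + k -> ~~ q x)%N ->
  filter q (iota m k) = [::].
Proof.
move=> h; apply/eqP; rewrite -[_ == _]negbK -has_filter; apply/hasPn => x.
by rewrite mem_iota => /h.
Qed.

Lemma index_iota_lt m k x y : (m <= x < m + k)%N -> (m <= y < m + k)%N -> (x < y)%N ->
  (index x (iota m k) < index y (iota m k))%N.
Proof.
have E z : (m <= z < m + k)%N -> index z (iota m k) = (z - m)%N.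
  move=> hz; rewrite -{1}(subnKC (proj1 (andP hz))) -(@nth_iota 0%N m k); last by lia.
  by rewrite index_uniq ?iota_uniq ?size_iota //; lia.
by move=> hx hy xy; rewrite !E //; lia.
Qed.

(** Within one chain, the precedence constraints say that the restriction of the schedule is
    increasing, hence an interval in order. Conversely, the two restrictions partition the schedule,
    which makes it a permutation of all jobs, and their order gives back the constraints. *)
Lemma feasible_shuffle (s : seq 'I_n) : feasible s = shuffle n1 n2 n1 n2 (map val s).
Proof.
have iE j : index (val j) (map val s) = index j s by rewrite index_map //; exact: val_inj.
have i1 : [seq x <- iota 0 n | x < n1]%N = iota 0 n1.
  rewrite iotaD filter_cat add0n [X in X ++ _]filter_iota_all
    ?[X in _ ++ X]filter_iota_none ?cats0 //.
  by move=> x /=; lia.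
have i2 : [seq x <- iota 0 n | n1 <= x]%N = iota n1 n2.
  rewrite iotaD filter_cat add0n [X in X ++ _]filter_iota_none ?[X in _ ++ X]filter_iota_all //.
  - by move=> x /andP[].
  - by move=> x /=; lia.
have pE : perm_eq s (enum 'I_n) = perm_eq (map val s) (iota 0 n).
  by rewrite -val_enum_ord; apply/idP/idP => [/(perm_map val)|/(perm_map_inj val_inj)].
rewrite /feasible /shuffle pE subnn addnK; apply/andP/andP => [[hp /forallP h]|[/eqP e1 /eqP e2]].
  have h' x y : x \in map val s -> y \in map val s -> (x < y)%N ->
      ((y < n1) || (n1 <= x))%N -> (index x (map val s) < index y (map val s))%N.
    move=> /mapP[j _ ->] /mapP[k _ ->] jk o; rewrite !iE.
    have /forallP/(_ k)/implyP := h j; apply; rewrite /prec jk.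
    by case/orP: o => ->; rewrite ?orbT.
  split; apply/eqP; apply: iota_sorted_unique.
  - by rewrite -i1; apply: perm_filter.
  - move=> x y; rewrite !mem_filter => /andP[qx xs] /andP[qy ys] xy.
    by rewrite index_filter_lt //; apply: h' => //; rewrite qy.
  - by rewrite -i2; apply: perm_filter.
  - move=> x y; rewrite !mem_filter => /andP[qx xs] /andP[qy ys] xy.
    by rewrite index_filter_lt //; apply: h' => //; rewrite qx orbT.
split.
  rewrite -(permPl (permEl (perm_filterC (fun x => x < n1)%N _))) e1.
  have -> : [seq x <- map val s | predC (fun x => x < n1)%N x] = iota n1 n2.
    by rewrite -e2; apply: eq_filter => x /=; rewrite -leqNgt.
  by rewrite iotaD add0n.
apply/forallP => j; apply/forallP => k; apply/implyP => /orP[]/andP[h1 h2]; rewrite -!iE.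
  rewrite -(@index_filter_lt _ (fun x => x < n1)%N) ?e1 //=; last by lia.
  by apply: index_iota_lt; lia.
rewrite -(@index_filter_lt _ (fun x => n1 <= x)%N) ?e2 //=; last by lia.
by apply: index_iota_lt => //; have := ltn_ord j; have := ltn_ord k; lia.
Qed.

Variables (p : R) (r d w : 'I_n -> R).

Definition due (obj : objective) (j : nat) : R := if obj is SumWT then ext d j else 0.

Lemma ext_val (f : 'I_n -> R) (j : 'I_n) : ext f j = f j.
Proof. by rewrite /ext valK. Qed.

(** Stated for every start time so that the induction can pass to the tail; uniqueness makes the
    positions of the tail's jobs shift by exactly one. *)
Lemma seqcostE obj t s : uniq s ->
  \sum_(j <- s) w j * Num.max 0 (nth 0 (completions p r t s) (index j s) - due obj j) =
  seqcost p (ext r) (due obj) (ext w) t (map val s).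
Proof.
elim: s t => [|j s IH] t /=; first by rewrite big_nil.
move=> /andP[js us]; rewrite big_cons eqxx /= /penalty /completion !ext_val -IH //.
congr (_ + _); apply: eq_big_seq => x xs.
by rewrite ifN_eqC //; apply: contraNneq js => <-.
Qed.

Lemma completions_gt0 t s x : 0 < p -> (forall j, 0 < r j) ->
  x \in completions p r t s -> 0 < x.
Proof.
move=> p0 r0; elim: s t => //= j s IH t; rewrite in_cons => /orP[/eqP ->|/IH //].
by rewrite addr_gt0 // lt_max r0.
Qed.

Lemma costE obj s : 0 < p -> (forall j, 0 < r j) -> feasible s ->
  cost obj p r d w s = seqcost p (ext r) (due obj) (ext w) 0 (map val s).
Proof.
move=> p0 r0 /andP[hp _]; have us : uniq s by rewrite (perm_uniq hp) enum_uniq.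
have ms j : j \in s by rewrite (perm_mem hp) mem_enum.
rewrite -seqcostE // (perm_big _ hp) big_enum /= /cost.
have sz u : size (completions p r u s) = size s by elim: s u {hp us ms} => //= j s IH u; rewrite IH.
case: obj; apply: eq_bigr => j _; rewrite /Tj /Cj /due ?ext_val // subr0 max_r //.
by apply: ltW; apply: (@completions_gt0 0 s) => //; rewrite mem_nth // sz index_mem.
Qed.

Lemma optimal_dp obj s : 0 < p -> (forall j, 0 < r j) ->
  map val s = (dp n1 n2 p (ext r) (due obj) (ext w) n n1 n2 0).2 ->
  optimal obj p r d w s.
Proof.
move=> p0 r0 es.
have fs : feasible s by rewrite feasible_shuffle es; apply: dp_shuffle.
split=> // s' fs'; rewrite !costE // es -dp_cost; apply: dp_le => //.
by rewrite -feasible_shuffle.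
Qed.

End Feasible.

(** * Register allocation and the code that evaluates one state *)

(* N-registers 0 to 11 hold constants once [setup_code] has run. *)
Local Notation vN1 := 0%N (only parsing).
Local Notation vN2 := 1%N (only parsing).
Local Notation vN := 2%N (only parsing).
Local Notation vOne := 3%N (only parsing).
Local Notation vD := 4%N (only parsing).
Local Notation vTab := 5%N (only parsing).
Local Notation vZero := 6%N (only parsing).
Local Notation vThree := 7%N (only parsing).
Local Notation vJobs := 8%N (only parsing).
Local Notation vN1S := 9%N (only parsing).
Local Notation vN2S := 10%N (only parsing).
Local Notation vOut := 11%N (only parsing).
Local Notation vA := 12%N (only parsing).
Local Notation vB := 13%N (only parsing).
Local Notation vI := 14%N (only parsing).
Local Notation vK := 15%N (only parsing).
Local Notation vHi := 16%N (only parsing).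
Local Notation vJ := 17%N (only parsing).
Local Notation vBase := 18%N (only parsing).
Local Notation vNI := 19%N (only parsing).
Local Notation vNK := 20%N (only parsing).
Local Notation vTmp := 21%N (only parsing).
Local Notation vJ1 := 22%N (only parsing).
Local Notation vNI1 := 23%N (only parsing).
Local Notation vNK1 := 24%N (only parsing).
Local Notation vSA := 25%N (only parsing).
Local Notation vSB := 26%N (only parsing).
Local Notation vM := 27%N (only parsing).

Local Notation xP := 0%N (only parsing).
Local Notation xZero := 1%N (only parsing).
Local Notation xT := 2%N (only parsing).
Local Notation xR := 3%N (only parsing).
Local Notation xD := 4%N (only parsing).
Local Notation xW := 5%N (only parsing).
Local Notation xV := 6%N (only parsing).
Local Notation xC := 7%N (only parsing).
Local Notation xV1 := 8%N (only parsing).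
Local Notation xC1 := 9%N (only parsing).
Local Notation xTmp := 10%N (only parsing).

(** Leaves in [vBase] the start of the table block for the counts [vSA] and [vSB], and in [vTmp] the
    address of the job's release date, from which [pen_code] reaches the due date and the weight by
    increments. *)
Definition addr_code : cmd := block
  [:: NMul vBase vSA vD; NAdd vBase vBase vSB; NMul vBase vBase vD; NMul vBase vBase vD;
      NAdd vBase vBase vTab; NMul vTmp vJ vThree; NAdd vTmp vTmp vJobs; RLoad xR vTmp].

Definition due_code (obj : objective) : instr :=
  if obj is SumWT then RLoad xD vTmp else RZero xD.

Definition start_code : cmd :=
  IfR xR xT
    (block [:: RAdd xC xT xP; NAdd vNI vI vZero; NAdd vNK vK vOne])
    (block [:: RAdd xC xR xP; NAdd vNI vJ vZero; NConst vNK 1]).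

Definition pen_code (obj : objective) : cmd :=
  Seq (block [:: NAdd vTmp vTmp vOne; due_code obj; NAdd vTmp vTmp vOne; RLoad xW vTmp;
                 RSub xV xC xD])
  (Seq (IfR xV xZero (Ins (RZero xV)) Skip)
       (Ins (RMul xV xW xV))).

Definition add_code : cmd := block
  [:: NMul vTmp vNI vD; NAdd vTmp vTmp vNK; NAdd vTmp vBase vTmp; RLoad xTmp vTmp;
      RAdd xV xV xTmp].

(* Cost of scheduling job N[vJ] next, when the remaining jobs are then described
   by N[vSA] and N[vSB]. *)
Definition try_code (obj : objective) : cmd :=
  Seq addr_code (Seq start_code (Seq (pen_code obj) add_code)).

Definition set1_code : cmd :=
  block [:: NSub vJ vN1 vA; NSub vSA vA vOne; NAdd vSB vB vZero].
Definition save_code : cmd := block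
  [:: NAdd vJ1 vJ vZero; NAdd vNI1 vNI vZero; NAdd vNK1 vNK vZero; RAdd xV1 xV xZero;
      RAdd xC1 xC xZero].
Definition set2_code : cmd :=
  block [:: NSub vJ vN vB; NAdd vSA vA vZero; NSub vSB vB vOne].
(** The whole successor state is restored, not only its value, because the forward pass continues
    from it. *)
Definition restore_code : cmd := block
  [:: NAdd vJ vJ1 vZero; NAdd vNI vNI1 vZero; NAdd vNK vNK1 vZero; RAdd xV xV1 xZero;
      RAdd xC xC1 xZero; NSub vSA vA vOne; NAdd vSB vB vZero].
Definition choose_code : cmd :=
  IfN vA vZero (IfN vB vZero (Ins (RZero xV)) Skip)
    (IfN vB vZero restore_code (IfR xV1 xV restore_code Skip)).
(** Both choices are evaluated even when a chain is exhausted: the job index is then [n1] or [n],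
    truncated subtraction keeps the count at 0, and [choose_code] discards the meaningless value. *)
Definition body_code (obj : objective) : cmd :=
  Seq set1_code (Seq (try_code obj) (Seq save_code (Seq set2_code
    (Seq (try_code obj) choose_code)))).

(** * Memory layout and correctness of one evaluation *)

Section Program.
Variables (R : realFieldType) (obj : objective) (n1 n2 : nat) (p : R).
Variables (r d w : 'I_(n1 + n2) -> R).
Local Notation n := (n1 + n2)%N.
Local Notation D := n.+1.
Local Notation jobs := (3 * n + 20)%N.
Local Notation tabs := (6 * n + 30)%N.
Local Notation outs := (n + 30)%N.
Local Notation fin := (completion p (ext r)).
Local Notation pen := (penalty (due d obj) (ext w)).
Local Notation F a b t := (dp n1 n2 p (ext r) (due d obj) (ext w) (a + b) a b t).

Definition consts : seq nat :=
  [:: n1; n2; n; 1; D; tabs; 0; 3; jobs; n1.+1; n2.+1; outs]%N.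

(** The range [j <= n] includes the fictitious job, whose data are all 0 by the default value of
    [ext]. *)
Record env (s : store R) : Prop := Env {
  envN : forall x, (x < 12)%N -> s.1 x = nth 0%N consts x;
  envP : s.2 xP = p;
  env0 : s.2 xZero = 0;
  envJ : forall j, (j <= n)%N ->
    [/\ s.2 (jobs + 3 * j)%N = ext r j, s.2 (jobs + 3 * j + 1)%N = ext d j
      & s.2 (jobs + 3 * j + 2)%N = ext w j] }.

Definition addr (a b i k : nat) : nat := (tabs + (((a * D + b) * D + i) * D + k))%N.

(** The current block consists of jobs already scheduled, so [k] is at most [n - (a + b)].
    Scheduling one more job preserves this bound, and all four indices are digits in base [n + 1],
    as [addr] requires. *)
Definition valid (a b i k : nat) : bool :=
  [&& a <= n1, b <= n2, i <= n & k + (a + b) <= n]%N.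

Lemma mulD_add_inj m x y x' y' : (y < m)%N -> (y' < m)%N ->
  (x * m + y = x' * m + y')%N -> x = x' /\ y = y'.
Proof.
move=> h h' e; split; last by have := congr1 (modn^~ m) e; rewrite !modnMDl !modn_small.
have m0 : (0 < m)%N by lia.
by have := congr1 (divn^~ m) e; rewrite !divnMDl // !divn_small // !addn0.
Qed.

Lemma addr_inj a b i k a' b' i' k' : valid a b i k -> valid a' b' i' k' ->
  addr a b i k = addr a' b' i' k' -> [/\ a = a', b = b', i = i' & k = k'].
Proof.
move=> /and4P[h1 h2 h3 h4] /and4P[h1' h2' h3' h4'] /addnI.
case/mulD_add_inj; try lia; case/mulD_add_inj; try lia; case/mulD_add_inj; try lia.
by move=> -> -> -> ->.
Qed.

Lemma env_frame c s : nostore c -> all (leq 12) (nwrites c) ->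
  all (fun x => 2 <= x < 20)%N (rwrites c) -> env s -> env (ev c s).
Proof.
move=> nc /allP hN /allP hR [eN eP e0 eJ].
have fR x : ~~ (2 <= x < 20)%N -> (ev c s).2 x = s.2 x.
  by move=> h; apply: ev_frameR => //; apply: contra h => /hR.
split=> [x hx|||j hj]; rewrite ?fR //; [|by apply: eJ|by lia|by lia|by lia].
by rewrite ev_frameN ?eN //; apply/negP => /hN; lia.
Qed.

(** Tells which table entry is read, not what it contains, so that it also applies to the index
    computed for an exhausted chain. *)
Lemma try_spec s : env s -> (s.1 vJ <= n)%N -> let s' := ev (try_code obj) s in
  [/\ s'.2 xC = fin (s.1 vJ) (s.2 xT),
      [/\ s'.1 vNI = s.1 vI, s'.1 vNK = (s.1 vK).+1 & s'.2 xC = s.2 xT + p] \/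
      [/\ s'.1 vNI = s.1 vJ, s'.1 vNK = 1%N & s'.2 xC = ext r (s.1 vJ) + p]
    & s'.2 xV = pen (s.1 vJ) (s'.2 xC) +
                s.2 (addr (s.1 vSA) (s.1 vSB) (s'.1 vNI) (s'.1 vNK))].
Proof.
move=> es hJ s'.
set s1 := ev addr_code s.
have es1 : env s1 by apply: env_frame.
have [b1 t1 r1] : [/\ s1.1 vBase = (tabs + (s.1 vSA * D + s.1 vSB) * D * D)%N,
    s1.1 vTmp = (jobs + 3 * s.1 vJ)%N & s1.2 xR = ext r (s.1 vJ)].
  have [eJ _ _] := envJ es hJ; rewrite -eJ.
  have e4 := envN es (isT : 4 < 12)%N; have e5 := envN es (isT : 5 < 12)%N.
  have e7 := envN es (isT : 7 < 12)%N; have e8 := envN es (isT : 8 < 12)%N.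
  rewrite /s1; case: s {es hJ s' s1 es1 eJ} e4 e5 e7 e8 => N X /= e4 e5 e7 e8.
  rewrite /upd /= e4 e5 e7 e8.
  by split; rewrite ?[(N 17 * 3)%N]mulnC 1?addnC.
have f1N x : x \notin [:: vBase; vTmp] -> s1.1 x = s.1 x.
  by move=> h; apply: ev_frameN => //; move: h; rewrite !inE; lia.
have f1R x : x != xR -> s1.2 x = s.2 x.
  by move=> h; apply: ev_frameR => //; rewrite mem_seq1.
set s2 := ev start_code s1.
have es2 : env s2 by apply: env_frame.
have f2N x : x \notin [:: vNI; vNK] -> s2.1 x = s1.1 x.
  by move=> h; apply: ev_frameN => //; move: h; rewrite !inE; lia.
have f2R x : x != xC -> s2.2 x = s1.2 x.
  by move=> h; apply: ev_frameR => //; rewrite !inE; lia.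
have [c2 n2E] : s2.2 xC = fin (s.1 vJ) (s.2 xT) /\
    ([/\ s2.1 vNI = s.1 vI, s2.1 vNK = (s.1 vK).+1 & s2.2 xC = s.2 xT + p] \/
     [/\ s2.1 vNI = s.1 vJ, s2.1 vNK = 1%N & s2.2 xC = ext r (s.1 vJ) + p]).
  have e3 := envN es1 (isT : 3 < 12)%N; have e6 := envN es1 (isT : 6 < 12)%N.
  have eP := envP es1; have e2 := f1R xT isT.
  have eJ := f1N vJ isT; have eI := f1N vI isT; have eK := f1N vK isT.
  rewrite /s2 /start_code; cbn [ev]; rewrite r1 e2 /completion; case: leP => _.
    move: e3 e6 eP e2 eI eK; case: (s1) => N X /= e3 e6 eP e2 eI eK; rewrite /upd /=.
    by rewrite e3 e6 eP e2 eI eK addn0 addn1; split=> //; left.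
  move: e3 e6 eP eJ r1; case: (s1) => N X /= e3 e6 eP eJ r1; rewrite /upd /=.
  by rewrite e6 eP eJ r1 addn0; split=> //; right.
set s3 := ev (pen_code obj) s2.
have es3 : env s3 by apply: env_frame; case: (obj).
have f3N x : x != vTmp -> s3.1 x = s2.1 x.
  by move=> h; apply: ev_frameN; case: (obj) => //; rewrite !inE; lia.
have f3R x : x \notin [:: xD; xW; xV] -> s3.2 x = s2.2 x.
  by move=> h; apply: ev_frameR; move: h; case: (obj) => //; rewrite !inE; lia.
have v3 : s3.2 xV = pen (s.1 vJ) (s2.2 xC).
  have [_ jd jw] := envJ es2 hJ.
  have e3 := envN es2 (isT : 3 < 12)%N; have e0 := env0 es2.
  have eT := f2N vTmp isT; rewrite t1 in eT; rewrite /s3 /pen_code /penalty /due -jw.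
  have aE : (jobs + 3 * s.1 vJ + 1 + 1 = jobs + 3 * s.1 vJ + 2)%N by lia.
  have a4 : (jobs + 3 * s.1 vJ + 2 == 4)%N = false by lia.
  move: e3 e0 eT jd; case: (s2) => N X /=; case: (obj) => /= e3 e0 eT; last move=> <-;
    by rewrite /upd /= e3 e0 eT aE a4; case: leP => _ /=.
have s'E : s' = ev add_code s3 by [].
rewrite s'E.
have [n4N n4K] : (ev add_code s3).1 vNI = s2.1 vNI /\ (ev add_code s3).1 vNK = s2.1 vNK.
  rewrite -!f3N //; split; exact: ev_frameN.
have c4 : (ev add_code s3).2 xC = s2.2 xC by rewrite -f3R //; apply: ev_frameR.
rewrite n4N n4K c4; split=> //; rewrite -v3.
set y := addr _ _ _ _.
(* The entry lies above all registers written so far, so reading it late gives its initial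
   content. *)
have -> : s.2 y = s3.2 y.
  rewrite f3R ?f2R ?f1R // /y ?inE /addr; lia.
have -> : y = (s3.1 vBase + (s3.1 vNI * D + s3.1 vNK))%N.
  by rewrite /y /addr !f3N // (f2N vBase) // b1; lia.
have e4 := envN es3 (isT : 4 < 12)%N.
by move: e4; case: (s3) => N X /= e4; rewrite /upd /= e4.
Qed.

Lemma dp_step a b t : (0 < a + b)%N ->
  let o1 := (pen (n1 - a) (fin (n1 - a) t) + (F a.-1 b (fin (n1 - a) t)).1,
             (n1 - a)%N :: (F a.-1 b (fin (n1 - a) t)).2) in
  let o2 := (pen (n - b) (fin (n - b) t) + (F a b.-1 (fin (n - b) t)).1,
             (n - b)%N :: (F a b.-1 (fin (n - b) t)).2) in
  F a b t = if (a <= 0)%N then o2 else if (b <= 0)%N then o1 else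
            if o1.1 <= o2.1 then o1 else o2.
Proof. by case: a => [|a]; case: b => [|b] //=; rewrite ?addnS. Qed.

Definition tab (dom : nat -> nat -> nat -> nat -> bool) (s : store R) : Prop :=
  forall a b i k, valid a b i k -> dom a b i k ->
    s.2 (addr a b i k) = (F a b (ext r i + k%:R * p)).1.

(** Only the blocks (a - 1, b) and (a, b - 1) matter; describing them with successors makes them
    empty when [a] or [b] is 0. The value serves to fill the table, the second conclusion drives the
    forward pass. *)
Lemma body_spec s a b i k : env s -> valid a b i k ->
  s.1 vA = a -> s.1 vB = b -> s.1 vI = i -> s.1 vK = k ->
  s.2 xT = ext r i + k%:R * p ->
  tab (fun a' b' _ _ => (a'.+1 == a) && (b' == b)) s ->
  tab (fun a' b' _ _ => (a' == a) && (b'.+1 == b)) s ->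
  let s' := ev (body_code obj) s in
  s'.2 xV = (F a b (s.2 xT)).1 /\
  ((0 < a + b)%N ->
   [/\ (F a b (s.2 xT)).2 = s'.1 vJ :: (F (s'.1 vSA) (s'.1 vSB) (s'.2 xC)).2,
       valid (s'.1 vSA) (s'.1 vSB) (s'.1 vNI) (s'.1 vNK),
       s'.2 xC = ext r (s'.1 vNI) + (s'.1 vNK)%:R * p
     & (s'.1 vSA + s'.1 vSB).+1 = (a + b)%N]).
Proof.
move=> es va eA eB eI eK eT tA tB s'; have /and4P[la lb li lk] := va.
set s1 := ev set1_code s.
have es1 : env s1 by apply: env_frame.
have f1R x : s1.2 x = s.2 x by apply: ev_frameR.
have [J1 SA1 SB1] : [/\ s1.1 vJ = (n1 - a)%N, s1.1 vSA = a.-1 & s1.1 vSB = b].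
  have e0 := envN es (isT : 0 < 12)%N; have e3 := envN es (isT : 3 < 12)%N.
  have e6 := envN es (isT : 6 < 12)%N.
  move: e0 e3 e6 eA eB; rewrite /s1; case: (s) => N X /= e0 e3 e6 eA eB.
  by rewrite /upd /= e0 e3 e6 eA eB addn0 subn1.
have [I1 K1] : s1.1 vI = i /\ s1.1 vK = k 
  by rewrite -eI -eK; split; apply: ev_frameN.
have hJ1 : (s1.1 vJ <= n)%N by rewrite J1; lia.
have [] := try_spec es1 hJ1.
set s2 := ev (try_code obj) s1; rewrite f1R J1 SA1 SB1 I1 K1 => c2 n2E v2.
have es2 : env s2 by apply: env_frame; case: (obj).
set s3 := ev save_code s2.
have es3 : env s3 by apply: env_frame.
have [J3 NI3 NK3 V3 C3] : [/\ s3.1 vJ1 = (n1 - a)%N, s3.1 vNI1 = s2.1 vNI,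
    s3.1 vNK1 = s2.1 vNK, s3.2 xV1 = s2.2 xV & s3.2 xC1 = s2.2 xC].
  have e6 := envN es2 (isT : 6 < 12)%N; have e0 := env0 es2.
  have eJ : s2.1 vJ = (n1 - a)%N by rewrite -J1; apply: ev_frameN; case: (obj).
  move: e6 e0 eJ; rewrite /s3; case: (s2) => N X /= e6 e0 eJ.
  by rewrite /upd /= e6 e0 eJ !addn0 !addr0.
set s4 := ev set2_code s3.
have es4 : env s4 by apply: env_frame.
have f23N x : x \notin [:: vBase; vTmp; vNI; vNK; vJ1; vNI1; vNK1; vJ; vSA; vSB] ->
    s4.1 x = s.1 x.
  move=> h; rewrite /s4 /s3 /s2 /s1 !ev_frameN //; case: (obj) => //; move: h; rewrite !inE; lia.
have f23R x : x \notin [:: xR; xD; xW; xV; xC; xV1; xC1; xTmp] -> s4.2 x = s.2 x.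
  move=> h; rewrite /s4 /s3 /s2 /s1 !ev_frameR //; case: (obj) => //; move: h; rewrite !inE; lia.
have [J4 SA4 SB4] : [/\ s4.1 vJ = (n - b)%N, s4.1 vSA = a & s4.1 vSB = b.-1].
  have e2 := envN es3 (isT : 2 < 12)%N; have e3 := envN es3 (isT : 3 < 12)%N.
  have e6 := envN es3 (isT : 6 < 12)%N.
  have A3 : s3.1 vA = a by rewrite -eA -f23N //; apply/esym/ev_frameN.
  have B3 : s3.1 vB = b by rewrite -eB -f23N //; apply/esym/ev_frameN.
  move: e2 e3 e6 A3 B3; rewrite /s4; case: (s3) => N X /= e2 e3 e6 A3 B3.
  by rewrite /upd /= e2 e3 e6 A3 B3 addn0 subn1.
have hJ4 : (s4.1 vJ <= n)%N by rewrite J4; lia.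
have [] := try_spec es4 hJ4.
set s5 := ev (try_code obj) s4.
rewrite J4 SA4 SB4 f23R // !f23N // eI eK => c5 n5E v5.
have es5 : env s5 by apply: env_frame; case: (obj).
have f5N x : x \notin [:: vBase; vTmp; vNI; vNK] -> s5.1 x = s4.1 x.
  by move=> h; apply: ev_frameN; case: (obj) => //; move: h; rewrite !inE; lia.
have f5R x : x \notin [:: xR; xD; xW; xV; xC; xTmp] -> s5.2 x = s4.2 x.
  by move=> h; apply: ev_frameR; case: (obj) => //; move: h; rewrite !inE; lia.
set t := s.2 xT in eT c2 n2E c5 n5E *.
have o1 : (0 < a)%N -> [/\ s2.2 xV = pen (n1 - a) (s2.2 xC) + (F a.-1 b (s2.2 xC)).1,
    valid a.-1 b (s2.1 vNI) (s2.1 vNK) & s2.2 xC = ext r (s2.1 vNI) + (s2.1 vNK)%:R * p].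
  move=> a0; have v : valid a.-1 b (s2.1 vNI) (s2.1 vNK).
    by rewrite /valid; case: n2E => -[-> -> _]; lia.
  have c : s2.2 xC = ext r (s2.1 vNI) + (s2.1 vNK)%:R * p.
    by case: n2E => -[-> -> ->]; rewrite ?mul1r // eT -natr1 mulrDl mul1r addrA.
  by split=> //; rewrite v2 f1R tA ?prednK ?eqxx // -c.
have k4 a' b' i' k' : s4.2 (addr a' b' i' k') = s.2 (addr a' b' i' k').
  by apply: f23R; rewrite !inE /addr; lia.
have o2 : (0 < b)%N -> [/\ s5.2 xV = pen (n - b) (s5.2 xC) + (F a b.-1 (s5.2 xC)).1,
    valid a b.-1 (s5.1 vNI) (s5.1 vNK) & s5.2 xC = ext r (s5.1 vNI) + (s5.1 vNK)%:R * p].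
  move=> b0; have v : valid a b.-1 (s5.1 vNI) (s5.1 vNK).
    by rewrite /valid; case: n5E => -[-> -> _]; lia.
  have c : s5.2 xC = ext r (s5.1 vNI) + (s5.1 vNK)%:R * p.
    by case: n5E => -[-> -> ->]; rewrite ?mul1r // eT -natr1 mulrDl mul1r addrA.
  by split=> //; rewrite v5 k4 tB ?prednK ?eqxx // -c.
have e6 := envN es5 (isT : 6 < 12)%N; have e3 := envN es5 (isT : 3 < 12)%N.
have e0 := env0 es5.
have A5 : s5.1 vA = a by rewrite f5N // f23N.
have B5 : s5.1 vB = b by rewrite f5N // f23N.
have J5 : s5.1 vJ = (n - b)%N by rewrite f5N.
have SA5 : s5.1 vSA = a by rewrite f5N.
have SB5 : s5.1 vSB = b.-1 by rewrite f5N.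
have k4N x : x \in [:: vJ1; vNI1; vNK1] -> s5.1 x = s3.1 x.
  by rewrite !inE => h; transitivity (s4.1 x); [apply: f5N|apply: ev_frameN => //];
    rewrite /= !inE; lia.
have k4R x : x \in [:: xV1; xC1] -> s5.2 x = s3.2 x.
  by rewrite !inE => h; transitivity (s4.2 x); [apply: f5R|exact: ev_frameR];
    rewrite /= !inE; lia.
set s6 := ev restore_code s5.
have [J6 NI6 NK6 V6 C6] : [/\ s6.1 vJ = (n1 - a)%N, s6.1 vNI = s2.1 vNI,
    s6.1 vNK = s2.1 vNK, s6.2 xV = s2.2 xV & s6.2 xC = s2.2 xC].
  rewrite -J3 -NI3 -NK3 -V3 -C3 -!k4N // -!k4R //.
  move: e6 e0; rewrite /s6; case: (s5) => N X /= e6 e0.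
  by rewrite /upd /= e6 e0 !addn0 !addr0.
have [SA6 SB6] : s6.1 vSA = a.-1 /\ s6.1 vSB = b.
  move: e3 e6 A5 B5; rewrite /s6; case: (s5) => N X /= e3 e6 A5 B5.
  by rewrite /upd /= e3 e6 A5 B5 addn0 subn1.
have s'E : s' = if (a <= 0)%N then (if (b <= 0)%N then ev (Ins (RZero xV)) s5 else s5)
    else if (b <= 0)%N then s6 else if s2.2 xV <= s5.2 xV then s6 else s5.
  transitivity (ev choose_code s5) => //.
  by rewrite /choose_code; cbn [ev]; rewrite A5 B5 e6 k4R // V3.
have [ab0|ab] := posnP (a + b).
  have [a0 b0] : a = 0%N /\ b = 0%N by lia.
  rewrite s'E {1 2}a0 {1}b0 /=; split; last by rewrite ab0.
  by rewrite a0 b0 /=; case: (s5).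
rewrite dp_step //= -c2 -c5 s'E.
have R1 : (0 < a)%N -> [/\ valid (s6.1 vSA) (s6.1 vSB) (s6.1 vNI) (s6.1 vNK),
    s6.2 xC = ext r (s6.1 vNI) + (s6.1 vNK)%:R * p & (s6.1 vSA + s6.1 vSB).+1 = (a + b)%N].
  by move=> a0; have [_ ? ?] := o1 a0; rewrite SA6 SB6 NI6 NK6 C6; split=> //; lia.
have R2 : (0 < b)%N -> [/\ valid (s5.1 vSA) (s5.1 vSB) (s5.1 vNI) (s5.1 vNK),
    s5.2 xC = ext r (s5.1 vNI) + (s5.1 vNK)%:R * p & (s5.1 vSA + s5.1 vSB).+1 = (a + b)%N].
  by move=> b0; have [_ ? ?] := o2 b0; rewrite SA5 SB5; split=> //; lia.
have [a0|a0] := posnP a.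
  have b0 : (0 < b)%N by lia.
  have eA0 : (a <= 0)%N = true by lia.
  have eB0 : (b <= 0)%N = false by lia.
  rewrite eA0 eB0; have [V _ _] := o2 b0; have [? ? ?] := R2 b0.
  by rewrite V; split=> // _; split=> //; rewrite J5 SA5 SB5.
have eA0 : (a <= 0)%N = false by lia.
have [V1 _ _] := o1 a0; have [? ? ?] := R1 a0.
have G1 : s6.2 xV = pen (n1 - a) (s2.2 xC) + (F a.-1 b (s2.2 xC)).1 /\
    (n1 - a)%N :: (F a.-1 b (s2.2 xC)).2 = s6.1 vJ :: (F (s6.1 vSA) (s6.1 vSB) (s6.2 xC)).2.
  by rewrite V6 J6 SA6 SB6 C6.
case: G1 => G1 G2; rewrite eA0; have [b0|b0] := posnP b.
  by have -> : (b <= 0)%N = true by lia.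
have -> : (b <= 0)%N = false by lia.
have [V2 _ _] := o2 b0; have [? ? ?] := R2 b0.
rewrite -V1 -V2; case: ifP => _ //=.
by split=> // _; split=> //; rewrite J5 SA5 SB5.
Qed.

(** * Filling the table *)

Local Notation L := (dp n1 n2 p (ext r) (due d obj) (ext w) (n1 + n2) n1 n2 0).2.

(** [xT] advances together with [k]: no instruction turns an index into a real, so r_i + k p is
    maintained by additions. *)
Definition store_code : cmd := block
  [:: NMul vTmp vA vD; NAdd vTmp vTmp vB; NMul vTmp vTmp vD; NAdd vTmp vTmp vI;
      NMul vTmp vTmp vD; NAdd vTmp vTmp vK; NAdd vTmp vTab vTmp; RStore vTmp xV;
      RAdd xT xT xP; NAdd vK vK vOne].

Definition loopK_code : cmd := While vK vHi (Seq (body_code obj) store_code).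
Definition loopI_code : cmd := While vI vD
  (Seq (block [:: NMul vTmp vI vThree; NAdd vTmp vJobs vTmp; RLoad xT vTmp; NConst vK 0])
  (Seq loopK_code (Ins (NAdd vI vI vOne)))).
Definition loopB_code : cmd := While vB vN2S
  (Seq (block [:: NAdd vHi vA vB; NSub vHi vD vHi; NConst vI 0])
  (Seq loopI_code (Ins (NAdd vB vB vOne)))).
Definition table_code : cmd := Seq (Ins (NConst vA 0)) (While vA vN1S
  (Seq (Ins (NConst vB 0)) (Seq loopB_code (Ins (NAdd vA vA vOne))))).

(** The order in which the loops fill the table; both blocks consulted for (a, b) come earlier. *)
Definition before (a b i k a' b' i' k' : nat) : bool :=
  ((a' < a) || (a' == a) && ((b' < b) || (b' == b) &&
    ((i' < i) || (i' == i) && (k' < k))))%N.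

Lemma tab_sub (dom dom' : nat -> nat -> nat -> nat -> bool) s s' :
  (forall x, (tabs <= x)%N -> s'.2 x = s.2 x) ->
  (forall a b i k, valid a b i k -> dom' a b i k -> dom a b i k) ->
  tab dom s -> tab dom' s'.
Proof.
move=> hs hd h a b i k v dv; rewrite hs; last by rewrite /addr; lia.
by apply: h => //; apply: hd.
Qed.

Record invK a b i m s : Prop := InvK {
  invKenv : env s; invKA : s.1 vA = a; invKB : s.1 vB = b; invKI : s.1 vI = i;
  invKK : s.1 vK = m; invKH : s.1 vHi = (D - (a + b))%N;
  invKT : s.2 xT = ext r i + m%:R * p; invKtab : tab (before a b i m) s }.

Lemma invK_step a b i m s : valid a b i m -> invK a b i m s ->
  invK a b i m.+1 (ev (Seq (body_code obj) store_code) s).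
Proof.
move=> v [es eA eB eI eK eH eT ht].
have tA : tab (fun a' b' _ _ => (a'.+1 == a) && (b' == b)) s.
  by apply: tab_sub ht => // a' b' i' k' _; rewrite /before; lia.
have tB : tab (fun a' b' _ _ => (a' == a) && (b'.+1 == b)) s.
  by apply: tab_sub ht => // a' b' i' k' _; rewrite /before; lia.
have [V _] := body_spec es v eA eB eI eK eT tA tB.
cbn [ev]; set s1 := ev (body_code obj) s in V *.
have es1 : env s1 by apply: env_frame => //; case: (obj).
have fN x : x \in [:: vA; vB; vI; vK; vHi] -> s1.1 x = s.1 x.
  by rewrite !inE => h; apply: ev_frameN; case: (obj) => //=; rewrite !inE; lia.
have fR x : ~~ (3 <= x < 20)%N -> s1.2 x = s.2 x.
  by move=> h; apply: ev_frameR; case: (obj) => //=; rewrite !inE; lia.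
set s2 := ev store_code s1.
have f2N x : x \notin [:: vTmp; vK] -> s2.1 x = s1.1 x.
  rewrite /s2; case: (s1) => N X; rewrite !inE => /norP[/negbTE h /negbTE h'].
  by rewrite /= /upd /= !h h'.
have [K2 X2] : s2.1 vK = m.+1 /\
    s2.2 = upd (upd s1.2 (addr a b i m) (s1.2 xV)) xT (s1.2 xT + p).
  have e3 := envN es1 (isT : 3 < 12)%N; have e4 := envN es1 (isT : 4 < 12)%N.
  have e5 := envN es1 (isT : 5 < 12)%N; have eP := envP es1.
  have A1 : s1.1 vA = a by rewrite fN. have B1 : s1.1 vB = b by rewrite fN.
  have I1 : s1.1 vI = i by rewrite fN. have K1 : s1.1 vK = m by rewrite fN.
  have eq2 : (2 == addr a b i m) = false by rewrite /addr; lia.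
  have eq0 : (0 == addr a b i m) = false by rewrite /addr; lia.
  move: e3 e4 e5 eP A1 B1 I1 K1; rewrite /s2; case: (s1) => N X /= e3 e4 e5 eP A1 B1 I1 K1.
  rewrite /upd /= e3 e4 e5 A1 B1 I1 K1 -/(addr a b i m) eq2 eq0 eP addn1.
  by [].
have f2R x : x != xT -> x != addr a b i m -> s2.2 x = s1.2 x.
  by move=> h h'; rewrite X2 !updN.
have T2 : s2.2 xT = ext r i + m.+1%:R * p.
  by rewrite X2 upd_eq fR // eT -natr1 mulrDl mul1r addrA.
split=> //.
- case: es1 => hN hP h0 hJ; split=> [x hx|||j hj]; rewrite ?f2R //; try by rewrite /addr; lia.
  + by rewrite f2N ?hN // !inE; lia.
  + exact: hJ.
- by rewrite f2N ?fN.
- by rewrite f2N ?fN.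
- by rewrite f2N ?fN.
- by rewrite f2N ?fN.
- move=> a' b' i' k' v' bf.
  (* An entry before position [m.+1] is the one just written or an older one; by [addr_inj], only
     the former has the address just written. *)
  have [e|ne] := eqVneq (addr a' b' i' k') (addr a b i m).
    have [-> -> -> ->] := addr_inj v' v e.
    by rewrite X2 updN ?upd_eq ?V ?eT // /addr; lia.
  rewrite f2R ?fR ?ht //; try by rewrite /addr; lia.
  suff: ~~ [&& a' == a, b' == b, i' == i & k' == m] by move: bf; rewrite /before; lia.
  by apply: contraNN ne => /and4P[/eqP -> /eqP -> /eqP -> /eqP ->].
Qed.

(** The bounds of the nested loops carry growing constants 20, 30, 40, 50, so that each level has
    room for its own tests, jumps and counter updates. *)
Lemma loop_cost_le M M' c c' : (M <= M' -> 0 < M' -> c + 3 <= c' ->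
  M * (c + 2) + 1 <= M' * c')%N.
Proof.
move=> h h0 hc; apply: (@leq_trans (M' * (c + 3))%N); rewrite ?leq_mul2l ?hc ?orbT //.
by nia.
Qed.

Lemma loopK_spec a b i s : valid a b i 0 -> invK a b i 0 s ->
  tot loopK_code (D * (csize (body_code obj) + 20)) s (invK a b i (D - (a + b))).
Proof.
move=> /and4P[ha hb hi hk] h0.
apply: (tot_conseq _ _ (tot_while (M := D - (a + b)) h0 _ _)) => //; last first.
- move=> m s' hm h; apply: (tot_ev _ (invK_step _ h)); first by case: (obj).
  by apply/and4P; split=> //; lia.
- by move=> m s' hm [_ _ _ _ -> -> _ _].
- by apply: loop_cost_le; rewrite ?leq_subr //= leq_add2l.
Qed.

Record invI a b m s : Prop := InvI {
  invIenv : env s; invIA : s.1 vA = a; invIB : s.1 vB = b; invII : s.1 vI = m;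
  invIH : s.1 vHi = (D - (a + b))%N; invItab : tab (before a b m 0) s }.

Lemma loopI_spec a b s : (a <= n1)%N -> (b <= n2)%N -> invI a b 0 s ->
  tot loopI_code (D * (D * (csize (body_code obj) + 30))) s (invI a b D).
Proof.
move=> ha hb h0; pose T := (4 + (D * (csize (body_code obj) + 20) + 1))%N.
apply: (tot_conseq _ _ (tot_while (T := T) (M := D) h0 _ _)) => //; last first.
- move=> m s1 hm [es eA eB eI eH ht]; apply: tot_seq; apply: tot_ev => //.
  set c := block _; set s2 := ev c s1; apply: tot_seq.
  have v : valid a b m 0 by rewrite /valid; lia.
  apply: (tot_conseq _ _ (loopK_spec v _)) => //; last first.
    split; try by rewrite ev_frameN.
      exact: env_frame.
      by rewrite /s2; case: (s1).
      have [eJ _ _] := envJ es (hm : m <= n)%N.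
      have e7 := envN es (isT : 7 < 12)%N; have e8 := envN es (isT : 8 < 12)%N.
      move: eI e7 e8 eJ; rewrite /s2; case: (s1) => N X /= eI e7 e8 <-.
      by rewrite /upd /= eI e7 e8 mul0r addr0 (mulnC m).
    apply: tab_sub ht => // x hx; apply: ev_frameR => //; rewrite !inE; lia.
  move=> s3 [es3 A3 B3 I3 _ H3 _ t3]; apply: tot_ev => //.
  split; try by rewrite ev_frameN.
    exact: env_frame.
    have e3 := envN es3 (isT : 3 < 12)%N.
    by move: e3 I3; case: (s3) => N X /= -> ->; rewrite /upd /= addn1.
  (* Validity gives [k' <= n - (a + b)], so the completed inner loop has covered every valid
     [k']. *)
  apply: tab_sub t3 => [x hx|a' b' i' k' v']; first exact: ev_frameR.
  by move: v'; rewrite /valid /before; lia.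
- by move=> m s1 hm [es _ _ -> _ _]; rewrite (envN es) //=.
- by apply: loop_cost_le => //; rewrite /T; nia.
Qed.

Record invB a m s : Prop := InvB {
  invBenv : env s; invBA : s.1 vA = a; invBB : s.1 vB = m; invBtab : tab (before a m 0 0) s }.

Lemma loopB_spec a s : (a <= n1)%N -> invB a 0 s ->
  tot loopB_code (D * (D * (D * (csize (body_code obj) + 40)))) s (invB a n2.+1).
Proof.
move=> ha h0; pose T := (3 + (D * (D * (csize (body_code obj) + 30)) + 1))%N.
apply: (tot_conseq _ _ (tot_while (T := T) (M := n2.+1) h0 _ _)) => //; last first.
- move=> m s1 hm [es eA eB ht]; apply: tot_seq; apply: tot_ev => //.
  set c := block _; set s2 := ev c s1; apply: tot_seq.
  apply: (tot_conseq _ _ (loopI_spec ha (hm : m <= n2)%N _)) => //; last first.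
    split; try by rewrite ev_frameN.
      exact: env_frame.
      by rewrite /s2; case: (s1).
      have e4 := envN es (isT : 4 < 12)%N.
      by move: eA eB e4; rewrite /s2; case: (s1) => N X /= hA hB e4; rewrite /upd /= hA hB e4.
    by apply: tab_sub ht => // x hx; apply: ev_frameR.
  move=> s3 [es3 A3 B3 I3 H3 t3]; apply: tot_ev => //.
  split; try by rewrite ev_frameN.
    exact: env_frame.
    have e3 := envN es3 (isT : 3 < 12)%N.
    by move: e3 B3; case: (s3) => N X /= -> ->; rewrite /upd /= addn1.
  apply: tab_sub t3 => [x hx|a' b' i' k' v']; first exact: ev_frameR.
  by move: v'; rewrite /valid /before; lia.
- by move=> m s1 hm [es _ -> _]; rewrite (envN es) //=.
- by apply: loop_cost_le => //; rewrite /T; nia.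
Qed.

Record invA m s : Prop := InvA {
  invAenv : env s; invAA : s.1 vA = m; invAtab : tab (before m 0 0 0) s }.

Lemma table_spec s : env s ->
  tot table_code (D * (D * (D * (D * (csize (body_code obj) + 50))))) s
    (fun s' => env s' /\ tab (fun _ _ _ _ => true) s').
Proof.
move=> es; pose T := (1 + (D * (D * (D * (csize (body_code obj) + 40))) + 1))%N.
suff h : tot table_code (1 + (n1.+1 * (T + 2) + 1)) s (invA n1.+1).
  apply: tot_conseq h; first by rewrite /T; nia.
  move=> s' [es' _ ht]; split=> //; apply: tab_sub ht => // a b i k v _.
  by move: v; rewrite /valid /before; lia.
apply: tot_seq; apply: tot_ev => //; apply: tot_while.
- split; first exact: env_frame; first by case: (s).
  by move=> a b i k _; rewrite /before; lia.
- by move=> m s1 hm [es1 -> _]; rewrite (envN es1) //=.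
- move=> m s1 hm [es1 eA ht]; apply: tot_seq; apply: tot_ev => //.
  set c := Ins _; set s2 := ev c s1; apply: tot_seq.
  apply: (tot_conseq _ _ (loopB_spec (hm : m <= n1)%N _)) => //; last first.
    split; try by rewrite ev_frameN.
      exact: env_frame.
      by rewrite /s2; case: (s1).
    by apply: tab_sub ht => // x hx; apply: ev_frameR.
  move=> s3 [es3 A3 B3 t3]; apply: tot_ev => //.
  split; first exact: env_frame.
    have e3 := envN es3 (isT : 3 < 12)%N.
    by move: e3 A3; case: (s3) => N X /= -> ->; rewrite /upd /= addn1.
  apply: tab_sub t3 => [x hx|a' b' i' k' v']; first exact: ev_frameR.
  by move: v'; rewrite /valid /before; lia.
Qed.

(** * The forward pass *)

Definition emit_code : cmd := block
  [:: NAdd vTmp vOut vM; NStore vTmp vJ; NAdd vA vSA vZero; NAdd vB vSB vZero;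
      NAdd vI vNI vZero; NAdd vK vNK vZero; RAdd xT xC xZero; NAdd vM vM vOne].

Definition forward_code : cmd :=
  Seq (block [:: NAdd vA vN1 vZero; NAdd vB vN2 vZero; NAdd vI vN vZero; NConst vK 0;
                 RZero xT; NConst vM 0])
      (While vM vN (Seq (body_code obj) emit_code)).

(** [L] is the list that [dp] itself returns. The pass repeats its comparisons with the same
    tie-breaking, so it reproduces [L] and not merely some optimal order: what is left of [L] is the
    answer of [dp] at the current state. *)
Record invM m s : Prop := InvM {
  invMenv : env s; invMtab : tab (fun _ _ _ _ => true) s; invMM : s.1 vM = m;
  invMvalid : valid (s.1 vA) (s.1 vB) (s.1 vI) (s.1 vK);
  invMab : (s.1 vA + s.1 vB + m = n)%N;
  invMT : s.2 xT = ext r (s.1 vI) + (s.1 vK)%:R * p;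
  invMdrop : drop m L = (F (s.1 vA) (s.1 vB) (s.2 xT)).2;
  invMout : forall x, (x < m)%N -> s.1 (outs + x)%N = nth 0%N L x }.

Lemma invM_step m s : (m < n)%N -> invM m s ->
  invM m.+1 (ev (Seq (body_code obj) emit_code) s).
Proof.
move=> hm [es ht eM hv eab eT ed eo]; cbn [ev].
have tA : tab (fun a' b' _ _ => (a'.+1 == s.1 vA) && (b' == s.1 vB)) s by apply: tab_sub ht.
have tB : tab (fun a' b' _ _ => (a' == s.1 vA) && (b'.+1 == s.1 vB)) s by apply: tab_sub ht.
have [_] := body_spec es hv erefl erefl erefl erefl eT tA tB.
set s1 := ev (body_code obj) s; case; first by lia.
move=> eL v1 c1 ab1.
have es1 : env s1 by apply: env_frame => //; case: (obj).
have M1 : s1.1 vM = m by rewrite -eM; apply: ev_frameN; case: (obj).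
have o1 x : s1.1 (outs + x)%N = s.1 (outs + x)%N.
  by apply: ev_frameN; case: (obj) => //=; rewrite !inE; lia.
have r1 x : (20 <= x)%N -> s1.2 x = s.2 x.
  by move=> h; apply: ev_frameR; case: (obj) => //=; rewrite !inE; lia.
set s2 := ev emit_code s1.
have N2 x : x \notin [:: vTmp; vA; vB; vI; vK; vM] ->
    s2.1 x = if x == (outs + m)%N then s1.1 vJ else s1.1 x.
  rewrite !inE !negb_or =>
    /and5P[/negbTE h1 /negbTE h2 /negbTE h3 /negbTE h4 /andP[/negbTE h5 /negbTE h6]].
  have e11 := envN es1 (isT : 11 < 12)%N; move: e11 M1; rewrite /s2.
  by case: (s1) => N X /= e11 M1; rewrite /upd /= h1 h2 h3 h4 h5 h6 e11 M1.
have [A2 B2 [I2 K2] [M2 T2]] : [/\ s2.1 vA = s1.1 vSA, s2.1 vB = s1.1 vSB,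
    s2.1 vI = s1.1 vNI /\ s2.1 vK = s1.1 vNK & s2.1 vM = m.+1 /\ s2.2 xT = s1.2 xC].
  have e11 := envN es1 (isT : 11 < 12)%N; have e6 := envN es1 (isT : 6 < 12)%N.
  have e3 := envN es1 (isT : 3 < 12)%N; have e0 := env0 es1.
  have ne x : (x < 30)%N -> (x == outs + m)%N = false by lia.
  move: e11 e6 e3 e0 M1; rewrite /s2; case: (s1) => N X /= e11 e6 e3 e0 M1.
  by rewrite /upd /= e11 M1 !ne //= e6 e3 e0 !addn0 addr0 addn1.
have R2 x : x != xT -> s2.2 x = s1.2 x.
  by move=> h; rewrite /s2; case: (s1) => N X /=; rewrite updN.
have eLm : drop m L = s1.1 vJ :: (F (s1.1 vSA) (s1.1 vSB) (s1.2 xC)).2 by rewrite ed eL.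
split.
- case: es1 => hN hP h0 hJ; split=> [x hx|||j hj]; rewrite ?R2 //; try by lia.
  + by rewrite N2 ?ifF ?hN // ?inE; lia.
  + exact: hJ.
- by apply: tab_sub ht => // x hx; rewrite R2 ?r1 //; lia.
- by [].
- by rewrite A2 B2 I2 K2.
- by rewrite A2 B2; lia.
- by rewrite T2 I2 K2.
- by rewrite A2 B2 T2 -add1n -drop_drop eLm drop1.
- move=> x hx; rewrite N2 ?inE; last by lia.
  rewrite eqn_add2l; have [->|xm] := eqVneq x m.
    by have := nth_drop m 0%N L 0; rewrite eLm addn0.
  by rewrite o1 eo //; lia.
Qed.

Lemma ext_out (f : 'I_n -> R) : ext f n = 0.
Proof. by rewrite /ext insubF // ltnn. Qed.

Definition outbuf (s : store R) : Prop :=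
  forall x, (x < n)%N -> s.1 (outs + x)%N = nth 0%N L x.

Lemma forward_spec s : env s -> tab (fun _ _ _ _ => true) s ->
  tot forward_code (D * (csize (body_code obj) + 30)) s (fun s' => env s' /\ outbuf s').
Proof.
move=> es ht.
suff h : tot forward_code (6 + (n * ((csize (body_code obj) + 8) + 2) + 1)) s (invM n).
  by apply: tot_conseq h => [|s' [h1 _ _ _ _ _ _ h2]] //; nia.
apply: tot_seq; apply: tot_ev => //; apply: tot_while.
- set c := block _.
  have e0 := envN es (isT : 0 < 12)%N; have e1 := envN es (isT : 1 < 12)%N.
  have e2 := envN es (isT : 2 < 12)%N; have e6 := envN es (isT : 6 < 12)%N.
  have [A1 B1 [I1 K1] [M1 T1]] : [/\ (ev c s).1 vA = n1, (ev c s).1 vB = n2,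
      (ev c s).1 vI = n /\ (ev c s).1 vK = 0%N & (ev c s).1 vM = 0%N /\ (ev c s).2 xT = 0].
    move: e0 e1 e2 e6; case: (s) => N X /= e0 e1 e2 e6.
    by rewrite /upd /= e0 e1 e2 e6 !addn0.
  split=> //; rewrite ?A1 ?B1 ?I1 ?K1 ?T1 ?drop0 //.
  + exact: env_frame.
  + by apply: tab_sub ht => // x hx; apply: ev_frameR => //=; rewrite !inE; lia.
  + by rewrite /valid !leqnn.
  + by rewrite addn0.
  + by rewrite ext_out mul0r addr0.
- by move=> m s1 hm [es1 _ -> _ _ _ _ _]; rewrite (envN es1).
- move=> m s1 hm h; apply: (@tot_ev _ (Seq (body_code obj) emit_code)); first by case: (obj).
  exact: invM_step.
Qed.

(** * Moving the order into the output cells *)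

Definition copy_code : cmd := Seq (Ins (NConst vM 30)) (While vM vN (block
  [:: NAdd vTmp vOut vM; NLoad vJ vTmp; NStore vM vJ; NAdd vM vM vOne])).

Record invC m (s : store R) : Prop := InvC {
  invCN : forall x, (x < 12)%N -> s.1 x = nth 0%N consts x;
  invCM : s.1 vM = (30 + m)%N; invCbuf : outbuf s;
  invCout : forall x, (30 <= x < 30 + m)%N -> s.1 x = nth 0%N L x }.

Lemma copy_spec s : env s -> outbuf s -> tot copy_code (D * 20) s (invC (n - 30)).
Proof.
move=> es ho; apply: (@tot_conseq _ _ (1 + ((n - 30) * (4 + 2) + 1)) _ _ (invC (n - 30))) => //.
  by lia.
apply: tot_seq; apply: tot_ev => //; apply: tot_while.
- split=> [x hx||x hx|x]; last by lia.
  + by rewrite ev_frameN ?(envN es) //= inE; lia.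
  + by case: (s).
  + by rewrite ev_frameN ?ho //= inE; lia.
- by move=> m s1 hm [hN -> _ _]; rewrite hN //=; lia.
- move=> m s1 hm [hN hM hb hout]; apply: tot_ev => //.
  set c := block _.
  have [M2 N2] : (ev c s1).1 vM = (30 + m.+1)%N /\ forall x, x \notin [:: vTmp; vJ; vM] ->
      (ev c s1).1 x = if x == (30 + m)%N then s1.1 (outs + (30 + m))%N else s1.1 x.
    have e3 := hN 3%N isT; have e11 := hN 11%N isT.
    have ne x : (x < 30)%N -> (x == 30 + m)%N = false by lia.
    have ne' : (outs + (30 + m) == 21)%N = false by lia.
    move: e3 e11 hM; case: (s1) => N X /= e3 e11 hM.
    rewrite /upd /= e11 hM !ne //= e3 ne'; split; first by lia.
    move=> x; rewrite !inE !negb_or => /and3P[/negbTE h1 /negbTE h2 /negbTE h3].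
    by rewrite h1 h2 h3.
  split=> // [x hx|x hx|x hx]; rewrite N2 ?inE; try by lia.
  + by rewrite ifF ?hN //; lia.
  + by rewrite ifF ?hb //; lia.
  + by case: eqP => [->|ne]; [rewrite hb //; lia|apply: hout; lia].
Qed.

(** Cell 0 holds the base address [outs], which is already its own pointer; every other cell
    receives its index and then adds the base, without scratch space. *)
Fixpoint pointers_code (m : nat) : cmd :=
  if m is m'.+1 then Seq (pointers_code m') (block [:: NConst m m; NAdd m m 0]) else Skip.

Fixpoint derefs_code (m : nat) : cmd :=
  if m is m'.+1 then Seq (derefs_code m') (Ins (NLoad m' m')) else Skip.

(* The first 30 output cells double as working registers: each of them is first
   turned into a pointer to its final value, and then dereferenced in place. *)
Definition finish_code : cmd :=
  Seq (Ins (NAdd 0 vOut vZero)) (Seq (pointers_code 29) (derefs_code 30)).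

Lemma pointers_ev m (s : store R) x :
  (ev (pointers_code m) s).1 x = if (0 < x <= m)%N then (x + s.1 0)%N else s.1 x.
Proof.
elim: m x => [|m IH] x /=; first by case: x.
move: IH; case: (ev _ s) => N X /= IH; rewrite /upd /= !IH /=.
case: eqP => [->|ne]; first by rewrite eqxx leqnn.
by congr (if _ then _ else _); lia.
Qed.

Lemma derefs_ev m (s : store R) b x : (m <= 30)%N -> (30 <= b)%N ->
  (forall x, x < 30 -> s.1 x = b + x)%N ->
  (ev (derefs_code m) s).1 x = if (x < m)%N then s.1 (b + x)%N else s.1 x.
Proof.
move=> + hb hs; elim: m x => [|m IH] x hm //=.
have {}IH y := IH y (ltnW hm).
move: IH; case: (ev _ s) => N X /= IH.
have e1 : N m = (b + m)%N by rewrite IH ltnn hs.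
(* The sources lie at [b] or above, beyond the cells overwritten so far. *)
have e2 : N (b + m)%N = s.1 (b + m)%N by rewrite IH ifF //; lia.
rewrite /upd e1 e2 IH.
case: eqP => [->|ne]; first by rewrite ltnSn.
by congr (if _ then _ else _); lia.
Qed.

Lemma finish_spec s : invC (n - 30) s ->
  forall x, (x < n)%N -> (ev finish_code s).1 x = nth 0%N L x.
Proof.
move=> [hN _ hb ho] x hx; rewrite /finish_code.
set c1 := Ins _; set c2 := pointers_code _; set c3 := derefs_code _.
rewrite -[ev _ _]/(ev c3 (ev c2 (ev c1 s))).
have h1 y : (ev c1 s).1 y = if y == 0%N then outs else s.1 y.
  have e11 := hN 11%N isT; have e6 := hN 6%N isT.
  by move: e11 e6; case: (s) => N X /= e11 e6; rewrite /upd e11 e6 addn0.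
have h2 y : (ev c2 (ev c1 s)).1 y = if (y < 30)%N then (outs + y)%N else s.1 y.
  rewrite pointers_ev !h1 eqxx; case: (posnP y) => [->|y0]; first by rewrite addn0.
  by rewrite addnC.
rewrite (@derefs_ev 30 _ outs) ?leq_addl // => [|y hy]; rewrite !h2; last by rewrite hy.
have -> : (outs + x < 30)%N = false by lia.
by case: (ltnP x 30) => hx'; [apply: hb | apply: ho; lia].
Qed.

(** * Initialisation *)

Definition consts_code : cmd := block
  [:: NAdd vN vN1 vN2; NConst vOne 1; NAdd vD vN vOne; NConst vZero 0; NConst vThree 3;
      NMul vJobs vThree vN; NConst vTmp 20; NAdd vJobs vJobs vTmp;
      NConst vTmp 6; NMul vTab vTmp vN; NConst vTmp 30; NAdd vTab vTab vTmp;
      NAdd vOut vN vTmp; NAdd vN1S vN1 vOne; NAdd vN2S vN2 vOne;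
      RStore vJobs xZero; NConst vM 1; NMul vHi vThree vD].

(* The job data is moved out of the low registers, with the register [xZero] as
   scratch space: its own content is saved by the [RStore] in [consts_code]. *)
Definition move_code : cmd := While vM vHi (block
  [:: NAdd vTmp vM vOne; RLoad xZero vTmp; NAdd vTmp vJobs vM; RStore vTmp xZero;
      NAdd vM vM vOne]).

Definition setup_code : cmd := Seq consts_code (Seq move_code (Ins (RZero xZero))).

(** * The whole program and its running time *)

Definition main_code : cmd :=
  Seq setup_code (Seq table_code (Seq forward_code (Seq copy_code finish_code))).

Definition input : store R :=
  (nreg (init_state p r d w), rreg (init_state p r d w)).

Lemma input_job j : [/\ input.2 (1 + 3 * j)%N = ext r j, input.2 (1 + 3 * j + 1)%N = ext d j
  & input.2 (1 + 3 * j + 2)%N = ext w j].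
Proof.
have E k : (k < 3)%N -> ((1 + 3 * j + k - 1) %/ 3 = j /\ (1 + 3 * j + k - 1) %% 3 = k)%N.
  move=> h; have -> : (1 + 3 * j + k - 1 = j * 3 + k)%N by lia.
  by rewrite divnMDl // divn_small // modnMDl modn_small // addn0.
have [q0 m0] := E 0%N isT; have [q1 m1] := E 1%N isT; have [q2 m2] := E 2%N isT.
rewrite -{1}[(1 + 3 * j)%N]addn0 /input /= q0 m0 q1 m1 q2 m2.
by [].
Qed.

Record invS m (s : store R) : Prop := InvS {
  invSN : forall x, (x < 12)%N -> s.1 x = nth 0%N consts x;
  invSM : s.1 vM = m.+1; invSH : s.1 vHi = (3 * D)%N;
  invSX : forall x, (x < jobs)%N -> x != 1%N -> s.2 x = input.2 x;
  invSJ : forall y, (y <= m)%N -> s.2 (jobs + y)%N = input.2 (1 + y)%N }.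

Lemma setup_spec : tot setup_code (D * 100) input env.
Proof.
apply: (@tot_conseq _ _ (18 + (((3 * n + 2) * (5 + 2) + 1) + 1)) _ _ env) => //; first by lia.
apply: tot_seq; apply: tot_ev => //; apply: tot_seq.
apply: (tot_conseq (leqnn _) _ (tot_while (I := invS) _ _ _)) => //.
- move=> s [hN _ _ hX hJ]; apply: tot_ev => //.
  have hX' x : (jobs <= x)%N -> (ev (Ins (RZero xZero)) s).2 x = s.2 x.
    by move=> hx; apply: ev_frameR => //=; rewrite inE; lia.
  split=> [x hx|||j hj].
  + by rewrite ev_frameN ?hN.
  + by rewrite ev_frameR // hX //; lia.
  + by case: (s).
  + have [<- <- <-] := input_job j; rewrite !hX'; try by lia.
    by rewrite -!(addnA jobs) !hJ ?addnA //; lia.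
- have [N1 M1 H1 X1] : [/\ forall x, (x < 12)%N -> (ev consts_code input).1 x = nth 0%N consts x,
      (ev consts_code input).1 vM = 1%N, (ev consts_code input).1 vHi = (3 * D)%N
      & (ev consts_code input).2 = upd input.2 jobs (input.2 1%N)].
    have i0 : input.1 0%N = n1 by []. have i1 : input.1 1%N = n2 by [].
    move: i0 i1; case: (input) => N X /= i0 i1; rewrite /upd /= i0 i1 addn1; split=> // x.
    by do 12 ?[case: x => [|x] /=]; rewrite ?i0 ?i1 ?addn1.
  split=> // [x hx ne|y]; rewrite X1; first by rewrite updN //; lia.
  by rewrite leqn0 => /eqP ->; rewrite !addn0 upd_eq.
- by move=> m s hm [_ -> -> _ _]; lia.
- move=> m s hm [hN hM hH hX hJ]; apply: tot_ev => //; set c := block _.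
  have [N2 M2 X2] : [/\ forall x, x \notin [:: vTmp; vM] -> (ev c s).1 x = s.1 x,
      (ev c s).1 vM = m.+2 & (ev c s).2 = upd (upd s.2 1 (s.2 m.+2)) (jobs + m.+1) (s.2 m.+2)].
    have e3 := hN 3%N isT; have e8 := hN 8%N isT.
    move: e3 e8 hM; case: (s) => N X /= e3 e8 hM; split.
    * by move=> x; rewrite !inE !negb_or => /andP[/negbTE h1 /negbTE h2]; rewrite /upd !h1 h2.
    * by rewrite /upd /= e3 hM addn1.
    * by rewrite /upd /= e3 e8 hM addn1.
  split=> // [x hx||x hx ne|y hy].
  + by rewrite N2 ?hN // !inE; lia.
  + by rewrite N2.
  + by rewrite X2 !updN ?hX //; lia.
  + rewrite X2; have [->|ne] := eqVneq y m.+1; first by rewrite upd_eq hX //; lia.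
    by rewrite !updN ?hJ //; lia.
Qed.

Lemma main_spec : tot main_code
  (D * (D * (D * (D * (csize (body_code obj) * 2 + 400))))) input
  (fun s => forall x, (x < n)%N -> s.1 x = nth 0%N L x).
Proof.
pose K := csize (body_code obj).
(* One summand per phase; 89 = 1 + 2 * 29 + 30 is the size of [finish_code]. *)
pose T := (D * 100 + (D * (D * (D * (D * (K + 50)))) + (D * (K + 30) + (D * 20 + 89))))%N.
pose Q (s : store R) := forall x, (x < n)%N -> s.1 x = nth 0%N L x.
apply: (@tot_conseq _ _ T _ _ Q _) => //; last first.
  rewrite /T /K /main_code.
  apply: tot_seq; apply: (tot_conseq (leqnn _) _ setup_spec) => s1 es1.
  apply: tot_seq; apply: (tot_conseq (leqnn _) _ (table_spec es1)) => s2 [es2 t2].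
  apply: tot_seq; apply: (tot_conseq (leqnn _) _ (forward_spec es2 t2)) => s3 [es3 o3].
  apply: tot_seq; apply: (tot_conseq (leqnn _) _ (copy_spec es3 o3)) => s4 c4.
  by apply: tot_ev => //; exact: (finish_spec c4).
have E c : (D * (D * (D * (D * c))) = D * (D * (D * D)) * c)%N by rewrite !mulnA.
(* Only the table costs order D^4; the linear phases are absorbed through D <= D^4. *)
rewrite /T -/K !E; have h1 : (D <= D * (D * (D * D)))%N.
  by rewrite -[X in (X <= _)%N]muln1 leq_mul2l; apply/orP; right; nia.
by move: (D * (D * (D * D)))%N h1 => M h1; nia.
Qed.

End Program.

(** [output] silently drops values that are not job indices; the bound on the elements of [l]
    ensures that none is dropped. *)
Lemma map_val_output (R : realFieldType) n (s : state R) (l : seq nat) :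
  size l = n -> (forall x, x \in l -> (x < n)%N) ->
  (forall x, (x < n)%N -> nreg s x = nth 0%N l x) -> map val (output n s) = l.
Proof.
move=> sl ln hs; have e : [seq nreg s k | k <- iota 0 n] = l.
  apply: (@eq_from_nth _ 0%N); rewrite size_map size_iota // => i hi.
  by rewrite (nth_map 0%N) ?size_iota // nth_iota // add0n hs.
rewrite /output e (pmap_filter (insubK _)); apply/all_filterP/allP => x /ln hx.
by rewrite /= insubT.
Qed.

Lemma shuffle_lt n1 n2 s x : shuffle n1 n2 n1 n2 s -> x \in s -> (x < n1 + n2)%N.
Proof.
rewrite /shuffle subnn addnK => /andP[/eqP e1 /eqP e2] xs; case: (ltnP x n1) => hx; first by lia.
have : x \in iota n1 n2 by rewrite -e2 mem_filter hx.
by rewrite mem_iota => /andP[].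
Qed.

Theorem theorem1 :
  forall (R : realFieldType) (obj : objective),
  exists (P : program) (c N0 : nat),
  forall (n1 n2 : nat) (p : R) (r d w : 'I_(n1 + n2) -> R),
    0 < p -> (forall j, 0 < r j) -> (forall j, 0 <= w j) ->
    exists (t : nat) (s : state R),
      halts_in P (init_state p r d w) t s /\
      optimal obj p r d w (output (n1 + n2) s) /\
      ((N0 <= n1 + n2)%N -> (t <= c * (n1 + n2) ^ 5)%N).
Proof.
move=> R obj; set K := (csize (body_code obj) * 2 + 400)%N.
(* [K] depends on the code alone. The factor 16 = 2^4 and the threshold 1 come from n + 1 <= 2 n,
   applied to each of the four factors n + 1 of the bound. *)
exists (comp 0 (main_code obj)), (16 * K)%N, 1%N => n1 n2 p r d w p0 r0 _.
have [t [s [hh ht hQ]]] := tot_halts (main_spec obj p r d w).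
exists t, s; split=> //; split.
  have hsh := dp_shuffle p (ext r) (due d obj) (ext w) 0 (erefl (n1 + n2)%N) (leqnn n1) (leqnn n2).
  apply: optimal_dp => //; apply: map_val_output hQ; first exact: size_shuffle hsh.
  by move=> x; apply: shuffle_lt hsh.
move=> n0; apply: leq_trans ht _; rewrite -/K.
set n := (n1 + n2)%N in n0 *.
have h2 c c' : (c <= c' -> n.+1 * c <= 2 * n * c')%N by move=> hc; apply: leq_mul => //; lia.
apply: leq_trans (h2 _ _ (h2 _ _ (h2 _ _ (h2 _ _ (leqnn K))))) _.
have -> : (2 * n * (2 * n * (2 * n * (2 * n * K))) = 16 * K * n ^ 4)%N.
  by rewrite !expnS expn0; lia.
(* The bound obtained is of order n^4; the fifth power is a weakening. *)
by rewrite leq_mul2l expnS leq_pmull ?orbT.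
Qed.
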